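(* Let $f:\mathbb{N}\to\mathbb{Q}$ be a multiplicative function and $F(z)=\sum_{n\geq 1} f(n) z^n\in\mathbb{Q}[[z]]$, and suppose that $F(z)$ is algebraic over $\mathbb{Q}(z)$. Then either $f(n)$ is eventually zero or there is a nonnegative integer $k$ and a periodic multiplicative function $\chi$ on $\mathbb{N}$ such that $f(n)=n^k\chi(n)$ for all $n\in\mathbb{N}$.
   Context: $\mathbb{N}=\{1,2,3,\ldots\}$. A function $f$ on $\mathbb{N}$ is multiplicative if $f(mn)=f(m)f(n)$ whenever $\gcd(m,n)=1$. A function $\chi$ is periodic if there is $d\in\mathbb{N}$ with $\chi(n+d)=\chi(n)$ for all $n$. *)

(* Defs.v *)
(* The classical axioms of boolp are used only for the equality, choice and
   inversion operators on power series. *)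
From HB Require Import structures.
From mathcomp Require Import all_boot all_order all_algebra.
From mathcomp Require Import boolp.

Set Implicit Arguments.
Unset Strict Implicit.
Unset Printing Implicit Defensive.

Import GRing.Theory.
Local Open Scope ring_scope.
Local Open Scope quotient_scope.

(* A record, not an alias of [nat -> K], so that the pointwise product on
   functions is never inferred instead of the Cauchy product. *)
Record fps (K : Type) := Fps { fcoef : nat -> K }.

HB.instance Definition _ (K : Type) := gen_eqMixin (fps K).
HB.instance Definition _ (K : Type) := gen_choiceMixin (fps K).

Lemma fpsP (K : Type) (a b : fps K) : (forall n, fcoef a n = fcoef b n) <-> a = b.
Proof.
split=> [|-> //]; case: a b => [a] [b] /= ab; congr Fps; exact: funext.
Qed.

Section FpsRing.
Variable K : fieldType.
Implicit Types a b c : fps K.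

Definition fps_zero : fps K := Fps (fun _ => 0).
Definition fps_opp a := Fps (fun n => - fcoef a n).
Definition fps_add a b := Fps (fun n => fcoef a n + fcoef b n).
Definition fps_one : fps K := Fps (fun n => (n == 0%N)%:R).
Definition fps_mul a b :=
  Fps (fun n => \sum_(i < n.+1) fcoef a i * fcoef b (n - i)).

Fact fps_addA : associative fps_add.
Proof. by move=> a b c; apply/fpsP => n /=; rewrite addrA. Qed.
Fact fps_addC : commutative fps_add.
Proof. by move=> a b; apply/fpsP => n /=; rewrite addrC. Qed.
Fact fps_add0 : left_id fps_zero fps_add.
Proof. by move=> a; apply/fpsP => n /=; rewrite add0r. Qed.
Fact fps_addN : left_inverse fps_zero fps_opp fps_add.
Proof. by move=> a; apply/fpsP => n /=; rewrite addNr. Qed.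

HB.instance Definition _ :=
  GRing.isZmodule.Build (fps K) fps_addA fps_addC fps_add0 fps_addN.

Definition fps_trunc N a : {poly K} := \poly_(i < N.+1) fcoef a i.

Lemma coef_fps_trunc N a i : (i <= N)%N -> (fps_trunc N a)`_i = fcoef a i.
Proof. by move=> iN; rewrite coef_poly ltnS iN. Qed.

Lemma fcoef_mul_trunc N a b n : (n <= N)%N ->
  fcoef (fps_mul a b) n = (fps_trunc N a * fps_trunc N b)`_n.
Proof.
move=> nN; rewrite coefM; apply: eq_bigr => i _.
rewrite !coef_fps_trunc //; first exact: leq_trans (leq_subr _ _) nN.
by apply: leq_trans nN; rewrite -ltnS.
Qed.

Fact fps_mulC : commutative fps_mul.
Proof.
by move=> a b; apply/fpsP => n; rewrite !(fcoef_mul_trunc _ _ (leqnn n)) mulrC.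
Qed.

Fact fps_mulA : associative fps_mul.
Proof.
move=> a b c; apply/fpsP => n; pose T := fps_trunc n.
transitivity (T a * (T b * T c))`_n.
  rewrite coefM; apply: eq_bigr => i _; rewrite coef_fps_trunc -1?ltnS //.
  by rewrite (fcoef_mul_trunc _ _ (leq_subr i n)).
rewrite mulrA coefM; apply: eq_bigr => i _.
rewrite (coef_fps_trunc c) ?leq_subr //.
by rewrite (@fcoef_mul_trunc n) // -ltnS.
Qed.

Fact fps_mul1 : left_id fps_one fps_mul.
Proof.
move=> a; apply/fpsP => n /=; rewrite big_ord_recl big1 ?addr0 ?mul1r ?subn0 //.
by move=> i _; rewrite mul0r.
Qed.

Fact fps_mulDl : left_distributive fps_mul fps_add.
Proof.
move=> a b c; apply/fpsP => n /=; rewrite -big_split /=.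
by apply: eq_bigr => i _; rewrite mulrDl.
Qed.

Fact fps_one_neq0 : fps_one != 0.
Proof.
by apply/eqP => /fpsP /(_ 0%N) /= /eqP; rewrite oner_eq0.
Qed.

HB.instance Definition _ := GRing.Zmodule_isComNzRing.Build (fps K)
  fps_mulA fps_mulC fps_mul1 fps_mulDl fps_one_neq0.

Lemma fcoefM a b n :
  fcoef (a * b) n = \sum_(i < n.+1) fcoef a i * fcoef b (n - i).
Proof. by []. Qed.

Definition fps_unit : {pred fps K} := fun a => `[< exists b, b * a == 1 >].
Definition fps_inv a :=
  if pselect (exists b, b * a == 1) is left e then xchoose e else a.

Fact fps_mulV : {in fps_unit, left_inverse 1 fps_inv *%R}.
Proof.
move=> a /asboolP ua; rewrite /fps_inv; case: pselect => // e.
exact/eqP/(xchooseP e).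
Qed.
Fact fps_unitPl a b : b * a = 1 -> fps_unit a.
Proof. by move=> ba; apply/asboolP; exists b; apply/eqP. Qed.
Fact fps_inv_out : {in [predC fps_unit], fps_inv =1 id}.
Proof.
by move=> a /asboolP ua; rewrite /fps_inv; case: pselect.
Qed.

HB.instance Definition _ := GRing.ComNzRing_hasMulInverse.Build (fps K)
  fps_mulV fps_unitPl fps_inv_out.

Lemma fps_neq0P a :
  a != 0 -> exists2 m, fcoef a m != 0 & forall i, (i < m)%N -> fcoef a i = 0.
Proof.
move=> a0; have ex : exists n, fcoef a n != 0.
  apply: contrapT => h; case/eqP: a0; apply/fpsP => n /=; apply/eqP.
  by apply: contrapT => /negP an; apply: h; exists n.
case: (ex_minnP ex) => m am min_m; exists m => // i im; apply/eqP.
by apply: contraLR im => /min_m; rewrite -leqNgt.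
Qed.

Fact fps_integral (a b : fps K) : a * b = 0 -> (a == 0) || (b == 0).
Proof.
move=> ab0; apply: contrapT => /negP; rewrite negb_or => /andP[].
move=> /fps_neq0P[i ai ilt] /fps_neq0P[j bj jlt].
have /fpsP /(_ (i + j)%N) /= := ab0.
have ilt' : (i < (i + j).+1)%N by rewrite ltnS leq_addr.
rewrite (bigD1 (Ordinal ilt')) //= addKn big1 ?addr0 => [|k].
  by apply/eqP; rewrite mulf_neq0.
rewrite -val_eqE /= neq_ltn => /orP[/ilt -> |ik]; first by rewrite mul0r.
by rewrite jlt ?mulr0 // ltn_subLR ?ltn_add2r // -ltnS.
Qed.

HB.instance Definition _ :=
  GRing.ComUnitRing_isIntegral.Build (fps K) fps_integral.

Definition fps_of_poly (p : {poly K}) : fps K := Fps (fun n => p`_n).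

Fact fps_of_poly_is_zmod_morphism : zmod_morphism fps_of_poly.
Proof. by move=> p q; apply/fpsP => n /=; rewrite coefB. Qed.
Fact fps_of_poly_is_monoid_morphism : monoid_morphism fps_of_poly.
Proof.
by split=> [|p q]; apply/fpsP => n /=; rewrite ?coef1 ?coefM.
Qed.

HB.instance Definition _ := GRing.isZmodMorphism.Build {poly K} (fps K)
  fps_of_poly fps_of_poly_is_zmod_morphism.
HB.instance Definition _ := GRing.isMonoidMorphism.Build {poly K} (fps K)
  fps_of_poly fps_of_poly_is_monoid_morphism.

Lemma fps_of_poly_inj : injective fps_of_poly.
Proof. by move=> p q /fpsP pq; apply/polyP. Qed.

End FpsRing.

(* K((z)) is the fraction field of K[[z]]. *)
Notation laurent K := {fraction (fps K)}.

Section RatfunEmbedding.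
Variable K : fieldType.
Local Notation "x %:F" := (FracField.tofrac x).
Local Notation iota := (@fps_of_poly K).

Lemma fraction_numden (R : idomainType) (x : {fraction R}) :
  x = (\n_(repr x))%:F / (\d_(repr x))%:F.
Proof.
have d0 : (\d_(repr x))%:F != 0 by rewrite tofrac_eq0 denom_ratioP.
apply: (mulIf d0); rewrite divfK // -{1}[x]reprK.
unlock FracField.tofrac; rewrite -[LHS]FracField.pi_mul.
apply/eqmodP; rewrite /= FracField.equivfE /FracField.mulf.
by rewrite !numden_Ratio ?oner_neq0 ?mulr1 ?denom_ratioP // mulrC.
Qed.

(* The field embedding K(z) -> K((z)) extending K[z] -> K[[z]]; it does not
   depend on the representative n/d, see [laurent_of_ratfunE]. *)
Definition laurent_of_ratfun (x : {fraction {poly K}}) : laurent K :=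
  (iota \n_(repr x))%:F / (iota \d_(repr x))%:F.

Lemma tofrac_iota_neq0 (p : {poly K}) : p != 0 -> (iota p)%:F != 0.
Proof.
by move=> p0; rewrite tofrac_eq0 -(rmorph0 iota) (inj_eq (@fps_of_poly_inj K)).
Qed.

Lemma laurent_of_ratfunE (p q : {poly K}) : q != 0 ->
  laurent_of_ratfun (p%:F / q%:F) = (iota p)%:F / (iota q)%:F.
Proof.
move=> q0; rewrite /laurent_of_ratfun; set x := p%:F / q%:F.
have d0 : \d_(repr x) != 0 := denom_ratioP _.
apply/eqP; rewrite eqr_div ?tofrac_iota_neq0 // -!tofracM tofrac_eq -!rmorphM.
rewrite (inj_eq (@fps_of_poly_inj K)) -tofrac_eq !tofracM.
by rewrite -eqr_div ?tofrac_eq0 // -fraction_numden.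
Qed.

Fact laurent_of_ratfun_is_zmod_morphism : zmod_morphism laurent_of_ratfun.
Proof.
move=> x y; rewrite [x]fraction_numden [y]fraction_numden.
move: (\n_(repr x)) (\d_(repr x)) (denom_ratioP (repr x)) => p q q0.
move: (\n_(repr y)) (\d_(repr y)) (denom_ratioP (repr y)) => r s s0.
rewrite -mulNr -tofracN addf_div ?tofrac_eq0 // -!tofracM -tofracD.
rewrite !laurent_of_ratfunE ?mulf_neq0 // rmorphD !rmorphM rmorphN.
by rewrite tofracD !tofracM tofracN -addf_div ?tofrac_iota_neq0 // mulNr.
Qed.

Fact laurent_of_ratfun_is_monoid_morphism : monoid_morphism laurent_of_ratfun.
Proof.
split=> [|x y].
  have := laurent_of_ratfunE 1 (oner_neq0 {poly K}).
  by rewrite (rmorph1 iota) !tofrac1 !divr1.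
rewrite [x]fraction_numden [y]fraction_numden.
move: (\n_(repr x)) (\d_(repr x)) (denom_ratioP (repr x)) => p q q0.
move: (\n_(repr y)) (\d_(repr y)) (denom_ratioP (repr y)) => r s s0.
rewrite mulf_div -!tofracM !laurent_of_ratfunE ?mulf_neq0 //.
by rewrite !(rmorphM iota) !tofracM mulf_div.
Qed.

HB.instance Definition _ := GRing.isZmodMorphism.Build {fraction {poly K}}
  (laurent K) laurent_of_ratfun laurent_of_ratfun_is_zmod_morphism.
HB.instance Definition _ := GRing.isMonoidMorphism.Build {fraction {poly K}}
  (laurent K) laurent_of_ratfun laurent_of_ratfun_is_monoid_morphism.

Definition algebraic_fps (F : fps K) :=
  algebraicOver laurent_of_ratfun (FracField.tofrac F).

End RatfunEmbedding.

(* Functions on {1, 2, 3, ...} are encoded as functions on [nat]; their value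
   at 0 is never used. *)

Definition multiplicative_fun (f : nat -> rat) :=
  forall m n : nat, (0 < m)%N -> (0 < n)%N -> coprime m n -> f (m * n)%N = f m * f n.

Definition periodic_fun (chi : nat -> rat) :=
  exists2 d : nat, (0 < d)%N & forall n, (0 < n)%N -> chi (n + d)%N = chi n.

Definition eventually_zero (f : nat -> rat) :=
  exists N : nat, forall n, (N < n)%N -> f n = 0.

(* The series sum_(n >= 1) f(n) z^n. *)
Definition genfun (f : nat -> rat) : fps rat :=
  Fps (fun n => if n is 0%N then 0 else f n).

(* Main.v *)
(* Let [F = sum f(n) z^n] be algebraic. Then [f] satisfies a linear recurrence
   with polynomial coefficients, so if [f] is not eventually zero the Chinese
   remainder theorem leaves only finitely many primes [q] with [f(q^i) = 0] for
   some [i]. Fix another prime [q]. By multiplicativity all the functions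
   [x |-> f(q^l x + j)], [l >= 1], [q] not dividing [j], lie in the span over
   [C(x)] of [f(q^k x + i)], [i < r], for [k] large; hence they span a space [X]
   of dimension at most [r], which is stable under the shift [x |-> x + 1] and
   the dilation [x |-> q x] (after restricting to [l >= m]). If [A_M(x)] is the
   matrix of the [M]-fold shift and [B_k(x)] that of the [k]-fold dilation, then
     [A_(q^k)(q^k x) B_k(x) = B_k(x + 1) A_1(x)],
   so [A_(q^k)] has only [O(k)] poles and degree [O(k)]. A pole of [A_M] away
   from the two ends of the product would be repeated about [M] times, so up to
   a fixed denominator the [A_M] are polynomial matrices of degree
   [O(log^2 M)]; by dimension count they are linearly dependent over the
   constants. Thus, up to a polynomial factor, the functions in [X] satisfy
   recurrences with constant coefficients. If [al^n] occurs in [X], so does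
   [al^(q^k n)] for all [k], and finite dimension forces [al] to be a root of
   unity. So [f] is a rational function of [n] on the progression
   [n = 1 mod N], and multiplicativity makes it a power [n^k]; Eisenstein's
   theorem gives [k >= 0]. Finally [g(n) = f(n) / n^k] is periodic along
   [n + M Z] near each [n], which turns the recurrence of [f] into one with
   constant coefficients for [g], and [g] is periodic. *)
From HB Require Import structures.
Require Import Defs.
From mathcomp Require Import all_boot all_order all_algebra all_field.
From mathcomp Require Import cyclic boolp zify ring.
Set Implicit Arguments.
Unset Strict Implicit.
Unset Printing Implicit Defensive.
Import GRing.Theory Num.Theory.
Local Open Scope ring_scope.
Local Notation "p %:F" := (FracField.tofrac p).

(** * Rational functions: substitution, poles, degree *)

(** Every [size] is abstracted to a natural number variable, so that [lia] sees it as one atom. *)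
Ltac lia_size :=
  repeat match goal with H : context[@size ?T ?s] |- _ => move: H end;
  repeat match goal with |- context[@size ?T ?s] => move: (@size T s) => ? end;
  intros; lia.

Definition eventually (P : nat -> Prop) :=
  exists n0, forall n, (n0 <= n)%N -> P n.

Lemma eventually_and (P Q : nat -> Prop) :
  eventually P -> eventually Q -> eventually (fun n => P n /\ Q n).
Proof.
move=> [a Pa] [b Qb]; exists (maxn a b) => n; rewrite geq_max => /andP[an bn].
by split; [exact: Pa | exact: Qb].
Qed.

Lemma eventually_imp (P Q : nat -> Prop) :
  (forall n, P n -> Q n) -> eventually P -> eventually Q.
Proof. by move=> PQ [a Pa]; exists a => n /Pa /PQ. Qed.

Lemma eventually_all (I : finType) (P : I -> nat -> Prop) :
  (forall i, eventually (P i)) -> eventually (fun n => forall i, P i n).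
Proof.
move=> /choice[a Pa]; exists (\max_i a i) => n an i; apply: Pa.
by apply: leq_trans an; exact: leq_bigmax.
Qed.

Lemma eventually_comp (phi : nat -> nat) (P : nat -> Prop) :
  (forall n, (n <= phi n)%N) -> eventually P -> eventually (fun n => P (phi n)).
Proof. by move=> ph [a Pa]; exists a => n an; apply: Pa; exact: leq_trans (ph n). Qed.

Section FractionSubst.
Variables (R R' : idomainType) (phi : {rmorphism R -> R'}).
Hypothesis phi_inj : injective phi.

(** The injectivity proof is an argument, so that the ring morphism structure can be inferred from
    the term alone. *)
Definition fsubst of injective phi := fun x : {fraction R} =>
  (phi \n_(repr x))%:F / (phi \d_(repr x))%:F : {fraction R'}.
Local Notation sub := (fsubst phi_inj).

Let phi_neq0 (p : R) : p != 0 -> (phi p)%:F != 0 :> {fraction R'}.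
Proof. by move=> p0; rewrite tofrac_eq0 -(rmorph0 phi) (inj_eq phi_inj). Qed.

Lemma fsubstE (p q : R) : q != 0 -> sub (p%:F / q%:F) = (phi p)%:F / (phi q)%:F.
Proof.
move=> q0; rewrite /fsubst; set x := p%:F / q%:F.
have d0 : \d_(repr x) != 0 := denom_ratioP _.
apply/eqP; rewrite eqr_div ?phi_neq0 // -!tofracM tofrac_eq -!rmorphM.
rewrite (inj_eq phi_inj) -tofrac_eq !tofracM.
by rewrite -eqr_div ?tofrac_eq0 // -fraction_numden.
Qed.

Fact fsubst_is_zmod_morphism : zmod_morphism sub.
Proof.
move=> x y; rewrite [x]fraction_numden [y]fraction_numden.
move: (\n_(repr x)) (\d_(repr x)) (denom_ratioP (repr x)) => p q q0.
move: (\n_(repr y)) (\d_(repr y)) (denom_ratioP (repr y)) => r s s0.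
rewrite -mulNr -tofracN addf_div ?tofrac_eq0 // -!tofracM -tofracD.
rewrite !fsubstE ?mulf_neq0 // (rmorphD phi) !(rmorphM phi) (rmorphN phi).
by rewrite tofracD !tofracM tofracN -addf_div ?phi_neq0 // mulNr.
Qed.

Fact fsubst_is_monoid_morphism : monoid_morphism sub.
Proof.
split=> [|x y].
  have := fsubstE 1 (oner_neq0 R); by rewrite rmorph1 !tofrac1 !divr1.
rewrite [x]fraction_numden [y]fraction_numden.
move: (\n_(repr x)) (\d_(repr x)) (denom_ratioP (repr x)) => p q q0.
move: (\n_(repr y)) (\d_(repr y)) (denom_ratioP (repr y)) => r s s0.
by rewrite mulf_div -!tofracM !fsubstE ?mulf_neq0 // !(rmorphM phi) !tofracM mulf_div.
Qed.

HB.instance Definition _ := GRing.isZmodMorphism.Build {fraction R}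
  {fraction R'} sub fsubst_is_zmod_morphism.
HB.instance Definition _ := GRing.isMonoidMorphism.Build {fraction R}
  {fraction R'} sub fsubst_is_monoid_morphism.

Lemma fsubst_tofrac p : sub p%:F = (phi p)%:F.
Proof. by rewrite -[p%:F]divr1 -tofrac1 fsubstE ?oner_neq0 // rmorph1 tofrac1 divr1. Qed.

End FractionSubst.

Lemma fractionP (R : idomainType) (x : {fraction R}) :
  exists p q : R, q != 0 /\ x = p%:F / q%:F.
Proof. by exists \n_(repr x), \d_(repr x); rewrite -fraction_numden denom_ratioP. Qed.

Lemma common_denominator (R : idomainType) m n (M : 'M[{fraction R}]_(m, n)) :
  exists (D : R) (P : 'M[R]_(m, n)),
    D != 0 /\ D%:F *: M = map_mx (@FracField.tofrac R) P.
Proof.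
have /choice[pq hpq] : forall ij : 'I_m * 'I_n, exists pq : R * R,
    pq.2 != 0 /\ M ij.1 ij.2 = pq.1%:F / pq.2%:F.
  by move=> ij; have [p [q]] := fractionP (M ij.1 ij.2); exists (p, q).
pose D := \prod_ij (pq ij).2.
have D0 : D != 0 by apply/prodf_neq0 => ij _; case: (hpq ij).
exists D, (\matrix_(i, j) ((pq (i, j)).1 * \prod_(kl | kl != (i, j)) (pq kl).2)).
split=> //; apply/matrixP => i j; rewrite !mxE; case: (hpq (i, j)) => /= q0 ->.
rewrite /D (bigD1 (i, j)) //= !tofracM mulrCA; congr (_ * _).
by rewrite mulrC mulKf // tofrac_eq0.
Qed.

Section Affine.
Variable C : fieldType.
Implicit Types (a b al : C) (p q : {poly C}).

Definition linp b a : {poly C} := b *: 'X + a%:P.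

Lemma size_linp b a : b != 0 -> size (linp b a) = 2.
Proof.
move=> b0; rewrite size_polyDl ?size_scale ?size_polyX //.
by rewrite (leq_ltn_trans (size_polyC_leq1 _)).
Qed.

Lemma horner_linp b a al : (linp b a).[al] = b * al + a.
Proof. by rewrite !hornerE. Qed.

Lemma linp_comp b a b' a' : linp b a \Po linp b' a' = linp (b * b') (b * a' + a).
Proof.
rewrite /linp rmorphD /= comp_polyZ comp_polyX comp_polyC scalerDr scalerA.
by rewrite -addrA; congr (_ + _); rewrite !polyCD -mul_polyC polyCM.
Qed.

Lemma linp_id : linp 1 0 = 'X.
Proof. by rewrite /linp scale1r addr0. Qed.

Lemma linp_compK b a p : b != 0 ->
  (p \Po linp b a) \Po linp b^-1 (- a / b) = p.
Proof.
move=> b0; rewrite -comp_polyA linp_comp divff // mulrCA mulfV //.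
by rewrite mulr1 addNr linp_id comp_polyXr.
Qed.

Lemma linp_inj b a : b != 0 -> injective (fun p => p \Po linp b a).
Proof. by move=> b0; apply: can_inj (fun p => p \Po linp b^-1 (- a / b)) _ => p; exact: linp_compK. Qed.

Definition aff b (b0 : b != 0) a : {fraction {poly C}} -> {fraction {poly C}} :=
  fsubst (phi := comp_poly (linp b a)) (@linp_inj b a b0).

HB.instance Definition _ b (b0 : b != 0) a := GRing.RMorphism.on (aff b0 a).

Lemma affE b (b0 : b != 0) a p q : q != 0 ->
  aff b0 a (p%:F / q%:F) = (p \Po linp b a)%:F / (q \Po linp b a)%:F.
Proof. by move=> q0; rewrite /aff fsubstE. Qed.

Lemma aff_tofrac b (b0 : b != 0) a p : aff b0 a p%:F = (p \Po linp b a)%:F.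
Proof. by rewrite /aff fsubst_tofrac. Qed.

Lemma comp_linp_neq0 b a p : b != 0 -> p != 0 -> p \Po linp b a != 0.
Proof. by move=> b0 p0; rewrite comp_poly2_eq0 // size_linp. Qed.

Lemma affK b (b0 : b != 0) (b0' : b^-1 != 0) a r :
  aff b0' (- a / b) (aff b0 a r) = r.
Proof.
have [p [q [q0 ->]]] := fractionP r.
by rewrite (affE b0) // (affE b0') ?comp_linp_neq0 // !linp_compK.
Qed.

(** Absence of a pole at [al]. Any one representation with denominator nonvanishing at [al] will do,
    which avoids lowest terms. *)
Definition reg al (r : {fraction {poly C}}) :=
  exists p q, q.[al] != 0 /\ r = p%:F / q%:F.

Lemma horner_neq0 al q : q.[al] != 0 -> q != 0.
Proof. by apply: contraNneq => ->; rewrite horner0. Qed.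

Lemma reg_poly al p : reg al p%:F.
Proof. by exists p, 1; rewrite hornerC oner_neq0 tofrac1 divr1. Qed.

Lemma regD al r s : reg al r -> reg al s -> reg al (r + s).
Proof.
move=> [p [q [q0 ->]]] [p' [q' [q0' ->]]]; exists (p * q' + p' * q), (q * q').
by rewrite hornerM mulf_neq0 // tofracD !tofracM -addf_div // tofrac_eq0 (horner_neq0 q0, horner_neq0 q0').
Qed.

Lemma regM al r s : reg al r -> reg al s -> reg al (r * s).
Proof.
move=> [p [q [q0 ->]]] [p' [q' [q0' ->]]]; exists (p * p'), (q * q').
by rewrite hornerM mulf_neq0 // !tofracM mulf_div.
Qed.

Lemma reg_aff b (b0 : b != 0) a al r : reg (b * al + a) r -> reg al (aff b0 a r).
Proof.
move=> [p [q [q0 ->]]]; exists (p \Po linp b a), (q \Po linp b a).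
by rewrite affE ?(horner_neq0 q0) // horner_comp horner_linp.
Qed.

Lemma aff_reg b (b0 : b != 0) a al r : reg al (aff b0 a r) -> reg (b * al + a) r.
Proof.
have b0' : b^-1 != 0 by rewrite invr_eq0.
move=> h; rewrite -(affK b0 b0' a r); apply: reg_aff.
by rewrite mulrDr mulKf // -addrA mulNr [a / b]mulrC subrr addr0.
Qed.

Definition regm al m n (M : 'M[{fraction {poly C}}]_(m, n)) :=
  forall i j, reg al (M i j).

Lemma regmM al m n k (M : 'M_(m, n)) (N : 'M_(n, k)) :
  regm al M -> regm al N -> regm al (M *m N).
Proof.
move=> hM hN i j; rewrite mxE; elim/big_ind: _ => [|x y|l _].
- by rewrite -tofrac0; exact: reg_poly.
- exact: regD.
- exact: regM.
Qed.

Lemma regm1 al n : regm al (1%:M : 'M_n).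
Proof. by move=> i j; rewrite mxE; case: (i == j); rewrite ?mulr1n ?mulr0n -?tofrac1 -?tofrac0; exact: reg_poly. Qed.

Lemma regm_scale al m n r (M : 'M_(m, n)) : reg al r -> regm al M -> regm al (r *: M).
Proof. by move=> hr hM i j; rewrite mxE; exact: regM. Qed.

Lemma regm_aff b (b0 : b != 0) a al m n (M : 'M_(m, n)) :
  regm (b * al + a) M -> regm al (map_mx (aff b0 a) M).
Proof. by move=> h i j; rewrite mxE; apply: reg_aff. Qed.

Lemma aff_regm b (b0 : b != 0) a al m n (M : 'M_(m, n)) :
  regm al (map_mx (aff b0 a) M) -> regm (b * al + a) M.
Proof. by move=> h i j; have := h i j; rewrite mxE; exact: aff_reg. Qed.

(* The pole order at infinity is at most [e]. *)
Definition degle e (r : {fraction {poly C}}) :=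
  exists p q, [/\ q != 0, r = p%:F / q%:F & (size p <= size q + e)%N].

Lemma degle_leq e e' r : (e <= e')%N -> degle e r -> degle e' r.
Proof. by move=> ee [p [q [q0 -> s]]]; exists p, q; split=> //; lia_size. Qed.

Lemma degle0 e : degle e 0.
Proof. by exists 0, 1; rewrite oner_neq0 tofrac0 mul0r size_poly0. Qed.

Lemma degle_poly p : degle (size p) p%:F.
Proof. by exists p, 1; rewrite oner_neq0 tofrac1 divr1 leq_addl. Qed.

Lemma degle_ex r : exists e, degle e r.
Proof. by have [p [q [q0 ->]]] := fractionP r; exists (size p), p, q; rewrite leq_addl. Qed.

Lemma degleD e r s : degle e r -> degle e s -> degle e (r + s).
Proof.
move=> [p [q [q0 -> h]]] [p' [q' [q0' -> h']]].
exists (p * q' + p' * q), (q * q'); split.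
- by rewrite mulf_neq0.
- by rewrite tofracD !tofracM -addf_div // tofrac_eq0.
- rewrite (leq_trans (size_polyD _ _)) // geq_max (size_mul q0 q0').
  apply/andP; split; apply: leq_trans (size_polyMleq _ _) _; move: q0 q0'; rewrite -!size_poly_gt0; lia_size.
Qed.

Lemma degleM e e' r s : degle e r -> degle e' s -> degle (e + e') (r * s).
Proof.
move=> [p [q [q0 -> h]]] [p' [q' [q0' -> h']]].
exists (p * p'), (q * q'); split; rewrite ?mulf_neq0 // ?tofracM ?mulf_div // (size_mul q0 q0').
by apply: leq_trans (size_polyMleq _ _) _; move: q0 q0'; rewrite -!size_poly_gt0; lia_size.
Qed.

Lemma degle_aff e b (b0 : b != 0) a r : degle e r -> degle e (aff b0 a r).
Proof.
move=> [p [q [q0 -> h]]]; exists (p \Po linp b a), (q \Po linp b a).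
by rewrite comp_linp_neq0 // affE // !size_comp_poly2 ?size_linp.
Qed.

Lemma aff_degle e b (b0 : b != 0) a r : degle e (aff b0 a r) -> degle e r.
Proof.
have b0' : b^-1 != 0 by rewrite invr_eq0.
by move=> h; rewrite -(affK b0 b0' a r); apply: degle_aff.
Qed.

Lemma degle_tofrac e p : degle e p%:F -> (size p <= e.+1)%N.
Proof.
move=> [p' [q [q0 /eqP]]]; have q0' : q%:F != 0 :> {fraction {poly C}} by rewrite tofrac_eq0.
rewrite -(inj_eq (mulIf q0')) divfK // -tofracM tofrac_eq => /eqP <-.
have [->|p0] := eqVneq p 0; first by rewrite size_poly0.
by rewrite size_mul //; move: q0; rewrite -size_poly_gt0; lia_size.
Qed.

Definition degm e m n (M : 'M[{fraction {poly C}}]_(m, n)) :=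
  forall i j, degle e (M i j).

Lemma degmM e e' m n k (M : 'M_(m, n)) (N : 'M_(n, k)) :
  degm e M -> degm e' N -> degm (e + e') (M *m N).
Proof.
move=> hM hN i j; rewrite mxE; elim/big_ind: _ => [|x y|l _].
- exact: degle0.
- exact: degleD.
- exact: degleM.
Qed.

Lemma degm1 n : degm 0 (1%:M : 'M_n).
Proof.
move=> i j; rewrite mxE; case: (i == j); last exact: degle0.
by exists 1, 1; rewrite oner_neq0 tofrac1 divr1 addn0.
Qed.

Lemma degm_leq e e' m n (M : 'M_(m, n)) : (e <= e')%N -> degm e M -> degm e' M.
Proof. by move=> ee h i j; exact: degle_leq (h i j). Qed.

Lemma degm_ex m n (M : 'M_(m, n)) : exists e, degm e M.
Proof.
have /choice[e he] : forall ij : 'I_m * 'I_n, exists e, degle e (M ij.1 ij.2).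
  by move=> ij; exact: degle_ex.
exists (\max_ij e ij) => i j; apply: degle_leq (he (i, j)).
exact: (leq_bigmax (i, j)).
Qed.

Lemma degm_aff e b (b0 : b != 0) a m n (M : 'M_(m, n)) :
  degm e M -> degm e (map_mx (aff b0 a) M).
Proof. by move=> h i j; rewrite mxE; apply: degle_aff. Qed.

Lemma aff_degm e b (b0 : b != 0) a m n (M : 'M_(m, n)) :
  degm e (map_mx (aff b0 a) M) -> degm e M.
Proof. by move=> h i j; have := h i j; rewrite mxE; exact: aff_degle. Qed.

End Affine.

Section ClosedPoles.
Variable C : closedFieldType.

Lemma finite_roots (p : {poly C}) : p != 0 -> exists S : seq C, forall al, root p al -> al \in S.
Proof.
move=> p0; have [S pE] := closed_field_poly_normal p; exists S => al.
by rewrite pE rootZ ?lead_coef_eq0 // root_prod_XsubC.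
Qed.

Lemma finite_poles m n (M : 'M[{fraction {poly C}}]_(m, n)) :
  exists S : seq C, forall al, al \notin S -> regm al M.
Proof.
have [D [P [D0 DP]]] := common_denominator M.
have [S hS] := finite_roots D0; exists S => al /(contra (hS al)) Dal i j.
exists (P i j), D; split=> //; have D0' : D%:F != 0 :> {fraction {poly C}} by rewrite tofrac_eq0.
by apply: (mulIf D0'); rewrite divfK //; move/matrixP/(_ i j): DP; rewrite !mxE mulrC.
Qed.

(** Induction on the size of the denominator: by regularity, a root of the denominator is also a
    root of the numerator, and the common linear factor cancels. *)
Lemma everywhere_reg_poly (r : {fraction {poly C}}) :
  (forall al, reg al r) -> exists p : {poly C}, r = p%:F.
Proof.
move=> hr; have [p [q [q0 rE]]] := fractionP r.
have [k] := ubnP (size q); elim: k p q q0 rE => // k IH p q q0 rE kq.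
have [sq|sq] := eqVneq (size q) 1.
  have /size_poly1P[c c0 qE] : size q == 1 by rewrite sq.
  exists (c^-1 *: p); rewrite rE qE -mul_polyC mulrC tofracM; congr (_ * _).
  have cF : c%:P%:F != 0 :> {fraction {poly C}} by rewrite tofrac_eq0 polyC_eq0.
  by apply: (mulIf cF); rewrite mulVf // -tofracM -polyCM mulVf ?tofrac1.
have [al] := closed_rootP _ sq => qal.
have [p' [q' [q'al rE']]] := hr al.
have /eqP : p * q' = p' * q.
  apply/eqP; rewrite -tofrac_eq !tofracM -eqr_div ?tofrac_eq0 ?(horner_neq0 q'al) //.
  by rewrite -rE -rE'.
have /factor_theorem[q1 q1E] := qal; move=> /eqP pq.
have : root p al.
  have := congr1 (fun u => u.[al]) pq; rewrite !hornerM (rootP qal) mulr0.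
  by move/eqP; rewrite mulf_eq0 (negPf q'al) orbF.
case/factor_theorem=> p1 p1E.
have X0 : 'X - al%:P != 0 :> {poly C} by rewrite polyXsubC_eq0.
have q10 : q1 != 0 by apply: contraNneq q0 => q10; rewrite q1E q10 mul0r.
apply: (IH p1 q1) => //.
  by rewrite rE p1E q1E !tofracM -mulf_div divff ?mulr1 // tofrac_eq0.
by move: kq; rewrite q1E size_mul // size_XsubC; lia_size.
Qed.

End ClosedPoles.

(** * Rational matrices acting on germs of sequences *)

Lemma map_tofrac_inj (R : idomainType) m n :
  injective (map_mx (@FracField.tofrac R) : 'M_(m, n) -> 'M_(m, n)).
Proof.
move=> A B /matrixP AB; apply/matrixP => i j; have := AB i j; rewrite !mxE.
by move/eqP; rewrite tofrac_eq => /eqP.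
Qed.

Lemma left_kernel (R : idomainType) m n (M : 'M[{fraction R}]_(m, n)) :
  ~~ row_free M ->
  exists a : 'rV[R]_m, a != 0 /\ map_mx (@FracField.tofrac R) a *m M = 0.
Proof.
rewrite -kermx_eq0 => /rowV0Pn[v /sub_kermxP vM v0].
have [D [P [D0 DP]]] := common_denominator v; exists P; split.
  apply: contraNneq v0 => P0; move: DP; rewrite P0 map_mx0 => /eqP.
  by rewrite scalemx_eq0 tofrac_eq0 (negPf D0).
by rewrite -DP -scalemxAl vM scaler0.
Qed.

Section Germs.
Variable C : numFieldType.
Implicit Types (p D : {poly C}).

(** Otherwise the polynomial would have arbitrarily many natural numbers as roots; in characteristic
    zero these are distinct. *)
Lemma poly_eventually_neq0 p : p != 0 -> eventually (fun n => p.[n%:R] != 0).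
Proof.
move=> p0; apply: contrapT => h.
have hn n0 : exists n, (n0 <= n)%N /\ p.[n%:R] = 0.
  apply: contrapT => hn; apply: h; exists n0 => n nn; apply: contra_notN hn => /eqP pn.
  by exists n.
have rts k : exists2 s : seq nat, uniq s /\ size s = k & all (fun n => root p n%:R) s.
  elim: k => [|k [s [us sk] ps]]; first by exists [::].
  have [n [ns pn]] := hn (\max_(i <- s) i).+1.
  exists (n :: s); rewrite /= ?ps ?sk ?andbT ?us; last exact/rootP.
  split=> //; rewrite andbT; apply/negP => nin.
  by have := leq_bigmax_seq (F := id) (P := xpredT) _ nin isT; rewrite leqNgt ns.
have [s [us ss] ps] := rts (size p).
have : (size (map (fun n => n%:R : C) s) < size p)%N.
  apply: max_poly_roots => //; first by rewrite all_map.
  by rewrite map_inj_uniq //; apply: mulrIn; exact: oner_neq0.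
by rewrite size_map ss ltnn.
Qed.

Lemma poly_eventually_eq0 p : eventually (fun n => p.[n%:R] = 0) -> p = 0.
Proof.
move=> h; apply/eqP; apply: contrapT => /negP/poly_eventually_neq0 /(eventually_and h)[n0].
by move=> /(_ n0 (leqnn _))[->]; rewrite eqxx.
Qed.

Definition evm n k l (P : 'M[{poly C}]_(k, l)) : 'M[C]_(k, l) :=
  map_mx (horner_eval n%:R) P.

Lemma evm_mul n k l m (P : 'M_(k, l)) (Q : 'M_(l, m)) :
  evm n (P *m Q) = evm n P *m evm n Q.
Proof. exact: map_mxM. Qed.

Lemma evm_scale n k l p (P : 'M_(k, l)) : evm n (p *: P) = p.[n%:R] *: evm n P.
Proof. exact: map_mxZ. Qed.

Lemma evm_sub n k l (P Q : 'M_(k, l)) : evm n (P - Q) = evm n P - evm n Q.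
Proof. exact: map_mxB. Qed.

(** [Z(n) = R(n) Y(n)] for large [n]. The denominator [D] is cleared, so that only polynomials are
    ever evaluated. *)
Definition act k l (R : 'M[{fraction {poly C}}]_(k, l))
    (Y : nat -> 'cV[C]_l) (Z : nat -> 'cV[C]_k) :=
  exists D (P : 'M[{poly C}]_(k, l)),
    [/\ D != 0, D%:F *: R = map_mx (@FracField.tofrac _) P
      & eventually (fun n => D.[n%:R] *: Z n = evm n P *m Y n)].

(** Linear independence over [C(x)] of the entries of [Y] as germs at infinity; polynomial
    coefficients suffice after clearing denominators. *)
Definition vindep l (Y : nat -> 'cV[C]_l) := forall a : 'rV[{poly C}]_l,
  eventually (fun n => evm n a *m Y n = 0) -> a = 0.

(** The relation does not depend on the chosen denominator: two representations are cross-multiplied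
    and the nonzero factor [D1(n)] is cancelled. *)
Lemma act_rep k l (R : 'M_(k, l)) Y Z D (P : 'M[{poly C}]_(k, l)) :
  act R Y Z -> D != 0 -> D%:F *: R = map_mx (@FracField.tofrac _) P ->
  eventually (fun n => D.[n%:R] *: Z n = evm n P *m Y n).
Proof.
move=> [D1 [P1 [D10 RE h]]] D0 RE'.
have PP : D1 *: P = D *: P1.
  by apply: map_tofrac_inj; rewrite !map_mxZ -RE -RE' !scalerA mulrC.
have := poly_eventually_neq0 D10 => /(eventually_and h); apply: eventually_imp => n [hn nz].
apply: (scalerI nz); rewrite scalemxAl -evm_scale PP evm_scale -scalemxAl -hn.
by rewrite !scalerA mulrC.
Qed.

Lemma act_comp k l m (R : 'M_(k, l)) (S : 'M_(m, k)) Y Z W :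
  act R Y Z -> act S Z W -> act (S *m R) Y W.
Proof.
move=> [D [P [D0 RE h]]] [D' [P' [D0' SE h']]]; exists (D' * D), (P' *m P); split.
- by rewrite mulf_neq0.
- by rewrite map_mxM -RE -SE -scalemxAl -scalemxAr scalerA tofracM.
- apply: eventually_imp (eventually_and h h') => n [hn hn'].
  by rewrite hornerM evm_mul -mulmxA -hn -scalemxAr -hn' scalerA mulrC.
Qed.

(** The rows of the cross-multiplied difference are relations between the entries of [Y]. Matrix
    identities below are proved by comparing actions. *)
Lemma act_uniq k l (R S : 'M_(k, l)) Y Z :
  vindep Y -> act R Y Z -> act S Y Z -> R = S.
Proof.
move=> iY [D [P [D0 RE h]]] [D' [P' [D0' SE h']]].
have : D' *: P - D *: P' = 0.
  apply/row_matrixP => i; rewrite row0; apply: iY.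
  apply: eventually_imp (eventually_and h h') => n [hn hn'].
  rewrite /evm map_row -/(evm n _) -row_mul evm_sub mulmxBl !evm_scale -!scalemxAl -hn -hn'.
  by rewrite !scalerA mulrC subrr row0.
move=> /eqP; rewrite subr_eq0 => /eqP PP.
have DD : (D' * D)%:F != 0 :> {fraction {poly C}} by rewrite tofrac_eq0 mulf_neq0.
apply: (scalerI DD); rewrite {1}tofracM -scalerA RE mulrC tofracM -scalerA SE.
by rewrite -!map_mxZ PP.
Qed.

Lemma act_aff k l (R : 'M_(k, l)) Y Z q (q0 : q%:R != 0 :> C) j : (0 < q)%N ->
  act R Y Z ->
  act (map_mx (aff q0 j%:R) R) (fun n => Y (q * n + j)%N) (fun n => Z (q * n + j)%N).
Proof.
move=> qp [D [P [D0 RE h]]].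
exists (D \Po linp q%:R j%:R), (map_mx (comp_poly (linp q%:R j%:R)) P); split.
- exact: comp_linp_neq0.
- rewrite -(aff_tofrac q0) -map_mxZ RE; apply/matrixP => i i'.
  rewrite !mxE; exact: aff_tofrac.
- have hq n : (n <= q * n + j)%N by nia.
  apply: eventually_imp (eventually_comp hq h) => n.
  rewrite horner_comp horner_linp -natrM -natrD => ->; congr (_ *m _).
  by apply/matrixP => i i'; rewrite !mxE /horner_eval horner_comp horner_linp -natrM -natrD.
Qed.

(** A vector in the left kernel of [R] would be a relation between the entries of [Z]. With [k > l]
    this is the dimension count [act_dep]. *)
Lemma act_row_free k l (R : 'M_(k, l)) Y Z : act R Y Z -> vindep Z -> row_free R.
Proof.
move=> [D [P [D0 RE h]]] iZ; apply: contrapT => /negP/left_kernel[a [/negP a0 aR]].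
apply: a0; apply/eqP.
have aP : a *m P = 0.
  by apply: map_tofrac_inj; rewrite map_mxM -RE -scalemxAr aR scaler0 map_mx0.
have /eqP : D *: a = 0.
  apply: iZ; apply: eventually_imp h => n hn.
  by rewrite evm_scale -scalemxAl scalemxAr hn mulmxA -evm_mul aP /evm map_mx0 mul0mx.
by rewrite scalemx_eq0 (negPf D0) => /eqP.
Qed.

Lemma act_dep k l (R : 'M_(k, l)) Y Z : act R Y Z -> (l < k)%N -> ~ vindep Z.
Proof.
move=> h lk /(act_row_free h); rewrite /row_free => /eqP rk.
by have := rank_leq_col R; rewrite rk leqNgt lk.
Qed.

Definition vspan l (Y : nat -> 'cV[C]_l) (w : nat -> C) :=
  exists D (a : 'rV[{poly C}]_l), D != 0 /\
    eventually (fun n => D.[n%:R] *: (w n)%:M = evm n a *m Y n).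

Lemma act_exists k l (Y : nat -> 'cV_l) (Z : nat -> 'cV[C]_k) :
  (forall i, vspan Y (fun n => Z n i 0)) -> exists R, act R Y Z.
Proof.
move=> /choice[D /choice[a h]].
pose DD := \prod_i D i; pose E i := \prod_(j | j != i) D j.
have DD0 : DD != 0 by apply/prodf_neq0 => i _; case: (h i).
have DE i : DD = E i * D i by rewrite /DD (bigD1 i) //= mulrC.
pose P := \matrix_(i, j) (E i * a i 0 j).
exists (DD%:F^-1 *: map_mx (@FracField.tofrac _) P), DD, P; split=> //.
  by rewrite scalerA mulfV ?tofrac_eq0 // scale1r.
have /eventually_all := fun i => (h i).2; apply: eventually_imp => n hn.
apply/matrixP => i j; rewrite ord1 mxE; have /matrixP/(_ 0 0) := hn i.
rewrite !mxE eqxx mulr1n (DE i) hornerM -mulrA => ->.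
rewrite mulr_sumr; apply: eq_bigr => s _.
by rewrite !mxE /horner_eval hornerM mulrA.
Qed.

Lemma act_vspan k l (R : 'M_(k, l)) Y Z (b : 'rV_k) D w : act R Y Z -> D != 0 ->
  eventually (fun n => D.[n%:R] *: (w n)%:M = evm n b *m Z n) -> vspan Y w.
Proof.
move=> [D1 [P [D10 RE h]]] D0 h'; exists (D1 * D), (b *m P); rewrite mulf_neq0 //; split=> //.
apply: eventually_imp (eventually_and h h') => n [hn hn'].
by rewrite hornerM -scalerA hn' scalemxAr hn mulmxA -evm_mul.
Qed.

End Germs.

(** * Consistent shift and dilation systems *)

Lemma exp_gt_quadratic a b : exists k, (a * k ^ 2 + b < 2 ^ k)%N.
Proof.
(* From [k = 4] on, [(k + 1)^3 <= 2 k^3], and the factor [64 = 4^3] covers the smaller values. The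
   cubic lower bound then beats any quadratic. *)
have cube k : (k ^ 3 <= 64 * 2 ^ k)%N.
  elim: k => // -[|[|[|[|k]]]] // IH; rewrite [X in (_ <= _ * X)%N]expnS.
  by apply: leq_trans (_ : 2 * k.+4 ^ 3 <= _)%N; [rewrite !expnS; nia | lia].
exists (64 * (a + b) + 65)%N; move: (cube (64 * (a + b) + 65)%N).
rewrite !expnS expn0; nia.
Qed.

(** A finite set has finitely many integer differences. Applied to the poles of [A] and its inverse,
    [m] bounds the width of a cluster of poles congruent modulo the integers. *)
Lemma difference_bound (C : numFieldType) (S : seq C) :
  exists m, forall s s' n, s \in S -> s' \in S -> s = s' + n%:R -> (n < m)%N.
Proof.
have bnd (l : seq (C * C)) : exists m, forall ss n, ss \in l -> ss.1 = ss.2 + n%:R -> (n < m)%N.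
  elim: l => [|[s s'] l [m hm]]; first by exists 0.
  have [[n0 sE]|h] := pselect (exists n, s = s' + n%:R).
    exists (maxn m n0.+1) => ss n; rewrite inE => /orP[/eqP-> /=|ssl /(hm _ _ ssl)]; last by lia.
    by rewrite sE => /addrI/eqP; rewrite eqr_nat => /eqP ->; lia.
  exists m => ss n; rewrite inE => /orP[/eqP-> /= sE|]; last exact: hm.
  by case: h; exists n.
have [m hm] := bnd (allpairs pair S S).
by exists m => s s' n sS s'S; apply: (hm (s, s')); rewrite allpairs_f.
Qed.

Lemma invmx_mul (F : fieldType) n (M N : 'M[F]_n) :
  M \in unitmx -> N \in unitmx -> invmx (M *m N) = invmx N *m invmx M.
Proof.
move=> uM uN; have uMN : M *m N \in unitmx by rewrite unitmx_mul uM.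
have e : (invmx N *m invmx M) *m (M *m N) = 1%:M by rewrite mulmxA (mulmxKV uM) mulVmx.
by rewrite -[RHS](mulmxK uMN) e mul1mx.
Qed.

Lemma natr_expn_neq0 (C : numFieldType) q k : (1 < q)%N -> (q ^ k)%:R != 0 :> C.
Proof. by move=> q1; rewrite pnatr_eq0 -lt0n expn_gt0 ltnW. Qed.

Section ShiftAndDilation.
Variables (C : numClosedFieldType) (d q : nat) (Y : nat -> 'cV[C]_d).
Variables A B : 'M[{fraction {poly C}}]_d.
Hypothesis q_gt1 : (1 < q)%N.
Hypothesis Yindep : vindep Y.
Hypothesis actA : act A Y (fun n => Y n.+1).
Hypothesis actB : act B Y (fun n => Y (q * n)%N).
Hypothesis unitA : A \in unitmx.
Hypothesis unitB : B \in unitmx.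

Let one_nz : 1%:R != 0 :> C := oner_neq0 C.
Let qpow_nz k : (q ^ k)%:R != 0 :> C := natr_expn_neq0 C k q_gt1.

Local Notation sh j := (map_mx (aff one_nz j%:R)).
Local Notation sc k := (map_mx (aff (qpow_nz k) 0%:R)).

Lemma eq_act k l (R : 'M[{fraction {poly C}}]_(k, l)) Y1 Y2 Z1 Z2 :
  Y1 =1 Y2 -> Z1 =1 Z2 -> act R Y1 Z1 -> act R Y2 Z2.
Proof. by move=> /funext -> /funext ->. Qed.

(** [shiftmx M] and [dilmx k] are the matrices [A_M] and [B_k] of the overview. *)
Fixpoint shiftmx M : 'M[{fraction {poly C}}]_d :=
  if M is M'.+1 then sh M' A *m shiftmx M' else 1%:M.
Fixpoint dilmx k : 'M[{fraction {poly C}}]_d :=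
  if k is k'.+1 then sc k' B *m dilmx k' else 1%:M.

Lemma act_id : act 1%:M Y Y.
Proof.
exists 1, 1%:M; split; rewrite ?oner_neq0 //; first by rewrite tofrac1 scale1r map_mx1.
by exists 0 => n _; rewrite hornerC scale1r /evm map_mx1 mul1mx.
Qed.

Lemma act_shiftmx M : act (shiftmx M) Y (fun n => Y (n + M)%N).
Proof.
elim: M => [|M IH] /=; first by apply: eq_act act_id => // n; rewrite addn0.
apply: act_comp IH _; apply: eq_act (act_aff one_nz M (ltn0Sn 0) actA) => n;
  by rewrite mul1n ?addnS.
Qed.

Lemma act_dilmx k : act (dilmx k) Y (fun n => Y (q ^ k * n)%N).
Proof.
elim: k => [|k IH] /=; first by apply: eq_act act_id => // n; rewrite mul1n.
apply: act_comp IH _; have qp : (0 < q ^ k)%N by rewrite expn_gt0; lia.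
apply: eq_act (act_aff (qpow_nz k) 0 qp actB) => n; first by rewrite addn0.
by rewrite addn0 expnS mulnA.
Qed.

Lemma shiftmx_add a b : shiftmx (a + b) = sh a (shiftmx b) *m shiftmx a.
Proof.
apply: (act_uniq Yindep (act_shiftmx _)); apply: act_comp (act_shiftmx a) _.
apply: eq_act (act_aff one_nz a (ltn0Sn 0) (act_shiftmx b)) => n; rewrite mul1n //.
by rewrite addnA.
Qed.

(** Both sides carry [Y(n)] to [Y(q^k (n + 1)) = Y(q^k n + q^k)], and the matrix doing so is
    unique. *)
Lemma shiftmx_dilmx k : sc k (shiftmx (q ^ k)) *m dilmx k = sh 1 (dilmx k) *m A.
Proof.
have qp : (0 < q ^ k)%N by rewrite expn_gt0; lia.
apply: (@act_uniq _ _ _ _ _ Y (fun n => Y (q ^ k * n + q ^ k)%N) Yindep).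
  apply: act_comp (act_dilmx k) _.
  by apply: eq_act (act_aff (qpow_nz k) 0 qp (act_shiftmx _)) => n; rewrite addn0.
apply: act_comp actA _.
apply: eq_act (act_aff one_nz 1 (ltn0Sn 0) (act_dilmx k)) => n; first by rewrite mul1n addn1.
by rewrite mul1n mulnDr muln1.
Qed.

Lemma shiftmx_unit M : shiftmx M \in unitmx.
Proof.
elim: M => [|M IH] /=; first exact: unitmx1.
by rewrite unitmx_mul map_unitmx unitA IH.
Qed.

Lemma dilmx_unit k : dilmx k \in unitmx.
Proof.
elim: k => [|k IH] /=; first exact: unitmx1.
by rewrite unitmx_mul map_unitmx unitB IH.
Qed.


Lemma sc_shiftmx k : sc k (shiftmx (q ^ k)) = sh 1 (dilmx k) *m A *m invmx (dilmx k).
Proof. by rewrite -shiftmx_dilmx mulmxK ?dilmx_unit. Qed.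

Variables S T : seq C.
Hypothesis regS : forall al, al \notin S -> regm al A /\ regm al (invmx A).
Hypothesis regT : forall al, al \notin T -> regm al B /\ regm al (invmx B).
Variable m : nat.
Hypothesis gapS : forall s s' n, s \in S -> s' \in S -> s = s' + n%:R -> (n < m)%N.

Lemma regm_sh y j (M : 'M_d) : regm (y + j%:R) M -> regm y (sh j M).
Proof. by move=> h; apply: regm_aff; rewrite mul1r. Qed.

Lemma regm_sc y k (M : 'M_d) : regm ((q ^ k)%:R * y) M -> regm y (sc k M).
Proof. by move=> h; apply: regm_aff; rewrite addr0. Qed.

Lemma sh_regm y j (M : 'M_d) : regm y (sh j M) -> regm (y + j%:R) M.
Proof. by move/aff_regm; rewrite mul1r. Qed.

Lemma reg_shiftmx y M : (forall j, (j < M)%N -> y + j%:R \notin S) ->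
  regm y (shiftmx M) /\ regm y (invmx (shiftmx M)).
Proof.
elim: M => [|M IH] h /=; first by rewrite invmx1; split; exact: regm1.
have [//|h1 h2] := IH; first by move=> j jM; apply: h; lia.
have [r1 r2] := regS (h M (ltnSn M)).
rewrite invmx_mul ?(shiftmx_unit M) ?map_unitmx ?unitA // -map_invmx.
split; apply: regmM; [exact: (regm_sh r1) | exact: h1 | exact: h2 | exact: (regm_sh r2)].
Qed.

Lemma reg_dilmx y k : (forall i, (i < k)%N -> (q ^ i)%:R * y \notin T) ->
  regm y (dilmx k) /\ regm y (invmx (dilmx k)).
Proof.
elim: k => [|k IH] h /=; first by rewrite invmx1; split; exact: regm1.
have [//|h1 h2] := IH; first by move=> j jM; apply: h; lia.
have [r1 r2] := regT (h k (ltnSn k)).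
rewrite invmx_mul ?(dilmx_unit k) ?map_unitmx ?unitB // -map_invmx.
by split; apply: regmM; [exact: (regm_sc r1) | exact: h1 | exact: h2 | exact: (regm_sc r2)].
Qed.

(** At [s - a] the factor of index [j] can be singular only if [s - a + j] is in [S]. For
    [j < a - m] this point is more than [m] below [s], against the gap bound. [reg_right] is the
    same on the other side of the cluster. *)
Lemma reg_left s a : s \in S -> (m <= a)%N ->
  regm (s - a%:R) (shiftmx (a - m)) /\ regm (s - a%:R) (invmx (shiftmx (a - m))).
Proof.
move=> sS ma; apply: reg_shiftmx => j ja; apply/negP => sS'.
have := gapS sS sS' (n := (a - j)%N); rewrite natrB; last by lia.
by move=> h; suff : (a - j < m)%N by [lia]; apply: h; ring.
Qed.

Lemma reg_right s a N : s \in S ->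
  regm (s - a%:R) (sh (a + m) (shiftmx N)) /\ regm (s - a%:R) (invmx (sh (a + m) (shiftmx N))).
Proof.
move=> sS; rewrite -map_invmx.
have [] : regm (s + m%:R) (shiftmx N) /\ regm (s + m%:R) (invmx (shiftmx N)).
  apply: reg_shiftmx => j _; apply/negP => sS'.
  have := gapS sS' sS (n := (m + j)%N); rewrite natrD addrA => /(_ erefl); lia.
move=> h1 h2; have e : s - a%:R + (a + m)%:R = s + m%:R by rewrite natrD; ring.
by split; apply: regm_sh; rewrite e.
Qed.

(** The product is cut into the factors before the cluster, its crossing of length [2 * m], and the
    factors after it. *)
Lemma shiftmx_split M a : (m <= a)%N -> (a + m <= M)%N ->
  shiftmx M = sh (a + m) (shiftmx (M - (a + m))) *m (sh (a - m) (shiftmx (2 * m)) *m shiftmx (a - m)).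
Proof.
move=> ma aM; rewrite -shiftmx_add (_ : a - m + 2 * m = a + m)%N; last by lia.
by rewrite -shiftmx_add; congr shiftmx; lia.
Qed.

(* If the total crossing of a cluster of [S] had a pole, every long product
   would inherit it at each interior translate, i.e. at about [q ^ k] points for
   [M = q ^ k]; but by [sc_shiftmx] there are only [O(k)] poles. *)
Lemma reg_crossing s : s \in S -> regm (s - m%:R) (shiftmx (2 * m)).
Proof.
move=> sS; apply: contrapT => bad.
(* The two outer blocks and their inverses are regular at [s - a], so a regular product would make
   the crossing regular. *)
have badM M a : (m <= a)%N -> (a + m <= M)%N -> ~ regm (s - a%:R) (shiftmx M).
  move=> ma aM; rewrite (shiftmx_split ma aM) => h; apply: bad.
  have [_ l2] := reg_left sS ma; have [_ r2] := reg_right a (M - (a + m)) sS.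
  have u1 : sh (a + m) (shiftmx (M - (a + m))) \in unitmx by rewrite map_unitmx shiftmx_unit.
  have u2 : shiftmx (a - m) \in unitmx := shiftmx_unit _.
  have := regmM (regmM r2 h) l2.
  rewrite (mulKmx u1) (mulmxK u2) => /sh_regm.
  by rewrite natrB // (_ : s - a%:R + (a%:R - m%:R) = s - m%:R) //; ring.
(* The possible poles of [A_(q^k)], read off [sc_shiftmx] at [z = y / q^k]: they come from [A], from
   [B_k(x + 1)] and from the inverse of [B_k], in this order. *)
pose bads k := [seq (q ^ k)%:R * s | s <- S]
  ++ flatten [seq [seq (q ^ (k - i))%:R * t - (q ^ k)%:R | t <- T] | i <- iota 0 k]
  ++ flatten [seq [seq (q ^ (k - i))%:R * t | t <- T] | i <- iota 0 k].
have size_bads k : size (bads k) = (size S + 2 * k * size T)%N.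
  rewrite !size_cat size_map !size_flatten /shape -!map_comp.
  have e g (l : seq nat) :
      sumn [seq (size \o (fun i => [seq g i t : C | t <- T])) i | i <- l] = (size l * size T)%N.
    by elim: l => //= i l ->; rewrite size_map mulSn.
  by rewrite !e size_iota -mulnA mul2n -addnn.
have badsP k y : ~ regm y (shiftmx (q ^ k)) -> y \in bads k.
  move=> nreg; apply: contrapT => /negP; rewrite !mem_cat !negb_or => /and3P[n1 n2 n3].
  apply: nreg; pose z := y / (q ^ k)%:R.
  have yz : y = (q ^ k)%:R * z by rewrite mulrC divfK // qpow_nz.
  suff : regm z (sc k (shiftmx (q ^ k))) by move/aff_regm; rewrite addr0 -yz.
  have pw i : (i < k)%N -> (q ^ (k - i))%:R * (q ^ i)%:R = (q ^ k)%:R :> C.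
    by move=> ik; rewrite -natrM -expnD subnK // ltnW.
  rewrite sc_shiftmx; apply: regmM; first apply: regmM.
  - apply: regm_sh; apply: (reg_dilmx _).1 => i ik; apply: contra n2 => tT.
    apply/flatten_mapP; exists i; first by rewrite mem_iota.
    apply/mapP; exists ((q ^ i)%:R * (z + 1%:R)) => //.
    by rewrite mulrA pw // mulrDr -yz mulr1 addrK.
  - apply: (regS _).1; apply: contra n1 => zS; apply/mapP; by exists z.
  - apply: (reg_dilmx _).2 => i ik; apply: contra n3 => tT.
    apply/flatten_mapP; exists i; first by rewrite mem_iota.
    by apply/mapP; exists ((q ^ i)%:R * z) => //; rewrite mulrA pw.
(* [L] below lists [q ^ k - 2 * m] forced poles, but [bads k] has only [size S + 2 * k * size T]
   entries; this [k] makes the former exceed the latter. *)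
have [k hk] := exp_gt_quadratic (2 * size T) (size S + 2 * m).
have qk : (2 ^ k <= q ^ k)%N by case: (k) => // k'; rewrite leq_exp2r.
pose L := [seq s - a%:R | a <- iota m (q ^ k - 2 * m)].
have : (size L <= size (bads k))%N.
  apply: uniq_leq_size.
    rewrite map_inj_uniq ?iota_uniq // => a b /addrI/oppr_inj/eqP.
    by rewrite eqr_nat => /eqP.
  move=> y /mapP[a]; rewrite mem_iota => /andP[ma aM] ->; apply: badsP.
  by apply: badM => //; lia.
rewrite size_bads size_map size_iota.
have : (k <= k ^ 2)%N by rewrite expnS expn1; nia.
nia.
Qed.

Lemma reg_inner s M j : s \in S -> (m <= j)%N -> (j + m <= M)%N -> regm (s - j%:R) (shiftmx M).
Proof.
move=> sS mj jM; rewrite (shiftmx_split mj jM); apply: regmM; first exact: (reg_right _ _ sS).1.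
apply: regmM; last exact: (reg_left sS mj).1.
apply: regm_sh; rewrite natrB // (_ : s - j%:R + (j%:R - m%:R) = s - m%:R); last by ring.
exact: reg_crossing.
Qed.

Variables (c : {poly C}) (Am : 'M[{poly C}]_d).
Hypothesis cAm : c%:F *: shiftmx m = map_mx (@FracField.tofrac _) Am.

(** If [y + j] lies in [S] for some [j] between [m] and [M - m], then [reg_inner] gives regularity
    at [y]. Otherwise the middle factors are regular there, and the outer blocks of length [m] are
    cleared by [c(x)] and [c(x + M - m)]. *)
Lemma shiftmx_poly M : (2 * m <= M)%N -> exists P : 'M[{poly C}]_d,
  (c * (c \Po linp 1 (M - m)%:R))%:F *: shiftmx M = map_mx (@FracField.tofrac _) P.
Proof.
move=> mM; set R := _ *: _.
have regR y : regm y R.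
  have [[j [/andP[mj jM] yS]]|h] := pselect (exists j, (m <= j <= M - m)%N /\ y + j%:R \in S).
    apply: regm_scale; [exact: reg_poly | rewrite -[y](addrK j%:R)].
    by apply: reg_inner => //; lia.
  have RE : R = sh (M - m) (c%:F *: shiftmx m) *m (sh m (shiftmx (M - 2 * m)) *m (c%:F *: shiftmx m)).
    rewrite map_mxZ /= aff_tofrac -scalemxAl -!scalemxAr -shiftmx_add.
    rewrite (_ : m + (M - 2 * m) = M - m)%N; last by lia.
    rewrite -shiftmx_add /R tofracM mulrC -scalerA; congr (_ *: (_ *: shiftmx _)); lia.
  rewrite RE cAm; apply: regmM.
    by apply: regm_sh => i j; rewrite mxE; exact: reg_poly.
  apply: regmM; last by move=> i j; rewrite mxE; exact: reg_poly.
  apply: regm_sh; apply: (reg_shiftmx _).1 => j jM; apply/negP => yS; apply: h.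
  by exists (m + j)%N; rewrite natrD addrA yS; split=> //; lia.
have /choice[P PE] : forall ij : 'I_d * 'I_d, exists p, R ij.1 ij.2 = p%:F.
  by move=> ij; apply: everywhere_reg_poly => y; exact: regR.
exists (\matrix_(i, j) P (i, j)); apply/matrixP => i j.
by rewrite (PE (i, j)) !mxE.
Qed.

Variable e0 : nat.
Hypotheses (degA : degm e0 A) (degB : degm e0 B) (degBV : degm e0 (invmx B)).

Lemma degm_sh e j (M : 'M_d) : degm e M -> degm e (sh j M).
Proof. exact: degm_aff. Qed.

Lemma degm_sc e k (M : 'M_d) : degm e M -> degm e (sc k M).
Proof. exact: degm_aff. Qed.

Lemma deg_dilmx k : degm (k * e0) (dilmx k) /\ degm (k * e0) (invmx (dilmx k)).
Proof.
elim: k => [|k [IH1 IH2]] /=; first by rewrite invmx1; split; exact: degm1.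
rewrite invmx_mul ?(dilmx_unit k) ?map_unitmx ?unitB // -map_invmx mulSn; split.
  by apply: degmM; [exact: (degm_sc _ degB) | exact: IH1].
by rewrite addnC; apply: degmM; [exact: IH2 | exact: (degm_sc _ degBV)].
Qed.

(** Affine substitutions preserve the degree, so [sc_shiftmx] bounds it linearly in [k], although
    the product has [q ^ k] factors. *)
Lemma deg_shiftmx_pow k : degm ((2 * k + 1) * e0) (shiftmx (q ^ k)).
Proof.
apply: (aff_degm (b0 := qpow_nz k) (a := 0%:R)); rewrite sc_shiftmx.
rewrite (_ : (2 * k + 1) * e0 = k * e0 + e0 + k * e0)%N; last by lia.
apply: degmM; last exact: (deg_dilmx k).2.
by apply: degmM; [exact: (degm_sh _ (deg_dilmx k).1) | exact: degA].
Qed.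

Lemma deg_shiftmx_mul e M t : degm e (shiftmx M) -> degm (t * e) (shiftmx (t * M)).
Proof.
move=> h; elim: t => [|t IH]; first exact: degm1.
rewrite [(t.+1 * M)%N]mulSn addnC mulSn shiftmx_add.
by apply: degmM; [exact: (degm_sh _ h) | exact: IH].
Qed.

(** Base [q] expansion of [M]: each of its [k] digits contributes fewer than [q] blocks whose length
    is a power of [q], each of degree linear in [k]. *)
Lemma deg_shiftmx k M : (M < q ^ k)%N -> degm (k * (q * ((2 * k + 1) * e0))) (shiftmx M).
Proof.
elim: k M => [|k IH] M Mk.
  by rewrite expn0 in Mk; have -> : M = 0%N by [lia]; exact: degm1.
rewrite (divn_eq M (q ^ k)) [X in shiftmx X]addnC shiftmx_add.
have qp : (0 < q ^ k)%N by rewrite expn_gt0; lia.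
have hd : (M %/ q ^ k < q)%N by rewrite ltn_divLR // -expnS.
apply: (@degm_leq _ (M %/ q ^ k * ((2 * k + 1) * e0) + k * (q * ((2 * k + 1) * e0)))).
  nia.
apply: degmM; first by exact: (degm_sh _ (deg_shiftmx_mul _ (deg_shiftmx_pow k))).
by apply: IH; rewrite ltn_mod.
Qed.

End ShiftAndDilation.

(** * Polynomials in the shift operator *)

Section RecurrenceOperators.
Variable C : comNzRingType.
Implicit Types (L M : {poly C}) (h : nat -> C).

(** The operator [L(E)] applied to [h], where [E] is the shift; products of polynomials act as
    compositions, see [recopM]. *)
Definition recop L h n := \sum_(j < size L) L`_j * h (n + j)%N.

Lemma recopE k L h n : (size L <= k)%N -> recop L h n = \sum_(j < k) L`_j * h (n + j)%N.
Proof.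
move=> sk; rewrite /recop (big_ord_widen k (fun j => L`_j * h (n + j)%N)) //.
rewrite big_mkcond; apply: eq_bigr => j _; case: ltnP => // sj.
by rewrite nth_default // mul0r.
Qed.

Lemma recopD L M h n : recop (L + M) h n = recop L h n + recop M h n.
Proof.
have s1 : (size L <= maxn (size L) (size M))%N by rewrite leq_maxl.
have s2 : (size M <= maxn (size L) (size M))%N by rewrite leq_maxr.
rewrite (recopE _ _ s1) (recopE _ _ s2) (recopE _ _ (size_polyD _ _)) -big_split /=.
by apply: eq_bigr => j _; rewrite coefD mulrDl.
Qed.

Lemma recopZ c L h n : recop (c *: L) h n = c * recop L h n.
Proof.
rewrite (recopE _ _ (size_scale_leq _ _)) mulr_sumr.
by apply: eq_bigr => j _; rewrite coefZ mulrA.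
Qed.

Lemma recopC c h n : recop c%:P h n = c * h n.
Proof. by rewrite (recopE _ _ (size_polyC_leq1 c)) big_ord1 coefC addn0. Qed.

Lemma recopMX L h n : recop (L * 'X) h n = recop L h n.+1.
Proof.
rewrite (@recopE (size L).+1); last first.
  by apply: leq_trans (size_polyMleq _ _) _; rewrite size_polyX addn2.
rewrite big_ord_recl coefMX mul0r add0r; apply: eq_bigr => j _.
by rewrite coefMX /= addnS addSn.
Qed.

Lemma recopXsubC c h n : recop ('X - c%:P) h n = h n.+1 - c * h n.
Proof. by rewrite -[X in X - _]mul1r recopD -polyCN recopMX !recopC mul1r mulNr. Qed.

Lemma recopXnsub1 N h n : recop ('X^N - 1) h n = h (n + N)%N - h n.
Proof.
rewrite recopD -polyCN recopC mulN1r; congr (_ - _).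
elim: N n => [|N IH] n; first by rewrite expr0 recopC mul1r addn0.
by rewrite exprSr recopMX IH addSnnS.
Qed.

Lemma recopM L M h n : recop (L * M) h n = recop L (recop M h) n.
Proof.
elim/poly_ind: L n => [|L c IH] n; first by rewrite mul0r !recopC !mul0r.
rewrite mulrDl !recopD mul_polyC recopZ recopC -mulrA ['X * M]mulrC mulrA.
by rewrite !recopMX IH.
Qed.

Lemma recop_eventually0 L h : eventually (fun n => h n = 0) ->
  eventually (fun n => recop L h n = 0).
Proof.
by move=> [n0 h0]; exists n0 => n nn; rewrite /recop big1 // => j _; rewrite h0 ?mulr0 //; lia.
Qed.

Lemma recop_dvd L M h : eventually (fun n => recop L h n = 0) ->
  eventually (fun n => recop (M * L) h n = 0).
Proof.
by move/(recop_eventually0 M); apply: eventually_imp => n; rewrite recopM.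
Qed.

End RecurrenceOperators.

(** * Recurrences with constant coefficients by a dimension count *)

Section ConstantRecurrence.
Variables (C : numClosedFieldType) (d q : nat) (Y : nat -> 'cV[C]_d).
Variables A B : 'M[{fraction {poly C}}]_d.
Hypothesis q_gt1 : (1 < q)%N.
Hypothesis Yindep : vindep Y.
Hypothesis actA : act A Y (fun n => Y n.+1).
Hypothesis actB : act B Y (fun n => Y (q * n)%N).
Hypothesis unitA : A \in unitmx.
Hypothesis unitB : B \in unitmx.

(** After multiplication by [c(x) c(x + M - m)] the matrices [A_M] are polynomial with entries of
    degree polylogarithmic in [M]. Enough of them are linearly dependent over the constants, and the
    dependence acts on [Y] as a recurrence. *)
Lemma constant_recurrence : exists (c L : {poly C}), [/\ c != 0, L != 0
  & forall i, eventually (fun n => recop L (fun n => c.[n%:R] * Y n i 0) n = 0)].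
Proof.
have [S1 hS1] := finite_poles A; have [S2 hS2] := finite_poles (invmx A).
have [T1 hT1] := finite_poles B; have [T2 hT2] := finite_poles (invmx B).
pose S := S1 ++ S2; pose T := T1 ++ T2.
have regS al : al \notin S -> regm al A /\ regm al (invmx A).
  by rewrite mem_cat negb_or => /andP[/hS1 + /hS2].
have regT al : al \notin T -> regm al B /\ regm al (invmx B).
  by rewrite mem_cat negb_or => /andP[/hT1 + /hT2].
have [m gapS] := difference_bound S.
have [c [Am [c0 cAm]]] := common_denominator (shiftmx A m).
have [e1 he1] := degm_ex A; have [e2 he2] := degm_ex B; have [e3 he3] := degm_ex (invmx B).
pose e0 := (e1 + e2 + e3)%N.
have degA : degm e0 A by apply: degm_leq he1; rewrite /e0; lia.
have degB : degm e0 B by apply: degm_leq he2; rewrite /e0; lia.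
have degBV : degm e0 (invmx B) by apply: degm_leq he3; rewrite /e0; lia.
pose sc := size c.
(* The [N] matrices [A_M] with [2 * m <= M < q ^ K] will lie in a space of dimension [d * d * E],
   where [E] is at most [3 * q * e0 * K ^ 2 + 2 * sc + 1]; [K] is chosen so that [N] is larger. *)
have [K hK] := exp_gt_quadratic (d * d * (3 * q * e0)) (d * d * (sc + sc).+1 + 2 * m).
have qK : (2 ^ K <= q ^ K)%N by case: (K) => // K'; rewrite leq_exp2r.
pose e := (K * (q * ((2 * K + 1) * e0)))%N; pose E := (sc + sc + e).+1.
have KK : (K <= K ^ 2)%N by rewrite expnS expn1; nia.
have hE : (d * d * E <= d * d * (3 * q * e0) * K ^ 2 + d * d * (sc + sc).+1)%N.
  rewrite -[(d * d * _ * _)%N]mulnA -mulnDr leq_mul2l; apply/orP; right.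
  rewrite /E /e (_ : K * (q * ((2 * K + 1) * e0)) = q * e0 * (2 * K ^ 2 + K))%N; last first.
    by rewrite expnS expn1; ring.
  have : (q * e0 * (2 * K ^ 2 + K) <= q * e0 * (3 * K ^ 2))%N by rewrite leq_mul2l; apply/orP; right; lia.
  lia.
pose N := (q ^ K - 2 * m)%N.
have EN : (d * d * E < N)%N by rewrite /N; lia.
pose D i := c * (c \Po linp 1 (2 * m + i - m)%:R).
have D0 i : D i != 0 by rewrite mulf_neq0 // comp_linp_neq0 // oner_neq0.
have /choice[P hP] : forall i : 'I_N, exists P : 'M[{poly C}]_d,
    (D i)%:F *: shiftmx A (2 * m + i) = map_mx (@FracField.tofrac _) P.
  move=> i; have := shiftmx_poly q_gt1 Yindep actA actB unitA unitB regS regT gapS.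
  by move=> /(_ c Am cAm (2 * m + i)%N (leq_addr _ _)).
have sizeP i k l : (size (P i k l) <= E)%N.
  apply: degle_tofrac; have /matrixP/(_ k l) := hP i; rewrite !mxE => <-.
  apply: degleM; first rewrite tofracM.
    apply: degleM; first exact: degle_poly.
    rewrite /sc -(size_comp_poly2 c (size_linp (2 * m + i - m)%:R (oner_neq0 C))).
    exact: degle_poly.
  apply: (deg_shiftmx q_gt1 Yindep actA actB unitA unitB degA degB degBV).
  by case: i => i /=; rewrite /N; lia.
pose J := ('I_d * 'I_d * 'I_E)%type.
pose ev (t : 'I_#|{: J}|) : J := enum_val t.
pose Mx : 'M[C]_(N, #|{: J}|) := \matrix_(i, t) (P i (ev t).1.1 (ev t).1.2)`_((ev t).2).
have : ~~ row_free Mx.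
  rewrite /row_free neq_ltn; apply/orP; left; apply: leq_ltn_trans (rank_leq_col _) _.
  by rewrite !card_prod !card_ord.
rewrite -kermx_eq0 => /rowV0Pn[lam /sub_kermxP lamM lam0].
have lamP k l : \sum_i lam 0 i *: P i k l = 0.
  apply/polyP => j; rewrite coef_sum coef0.
  have [jE|jE] := ltnP j E; last first.
    rewrite big1 // => i _; rewrite coefZ nth_default ?mulr0 //.
    exact: leq_trans (sizeP _ _ _) jE.
  have /rowP/(_ (enum_rank ((k, l, Ordinal jE) : J))) := lamM; rewrite !mxE => e'; rewrite -[RHS]e'.
  by apply: eq_bigr => i _; rewrite coefZ !mxE /ev enum_rankK.
(* The coefficients [lam] belong to the shifts [2 * m + i], so lower coefficients of [L] are
   zero. *)
pose L := \poly_(j < 2 * m + N) (if (2 * m <= j)%N then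
   if insub (j - 2 * m)%N is Some i then lam 0 i else 0 else 0).
have Lcoef (i : 'I_N) : L`_(2 * m + i) = lam 0 i.
  rewrite coef_poly ltn_add2l ltn_ord leq_addr addKn insubT //= => ?.
  by congr (lam _ _); apply: val_inj.
(* With weight [c(x - m)], the value at [n + M] is the factor [c(n + M - m)] that clears [A_M]; the
   other factor [c(n)] does not depend on [M] and is cancelled. *)
exists (c \Po linp 1 (- m%:R)), L; split.
- by rewrite comp_linp_neq0 // oner_neq0.
- apply: contraNneq lam0 => L0; apply/eqP/rowP => i.
  by rewrite -Lcoef L0 coef0 mxE.
move=> i.
have /eventually_all acts : forall s : 'I_N, eventually (fun n =>
    (D s).[n%:R] *: Y (n + (2 * m + s))%N = evm n (P s) *m Y n).
  by move=> s; apply: act_rep (hP s) => //; exact: act_shiftmx.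
apply: eventually_imp (eventually_and acts (poly_eventually_neq0 c0)) => n [hn cn].
rewrite (@recopE _ (2 * m + N)); last exact: size_poly.
rewrite big_split_ord /= big1 ?add0r; last first.
  by move=> j _; rewrite coef_poly (_ : (2 * m <= j)%N = false) ?if_same ?mul0r // leqNgt ltn_ord.
apply: (mulfI cn); rewrite mulr0 mulr_sumr.
transitivity (\sum_s lam 0 s * (evm n (P s) *m Y n) i 0).
  apply: eq_bigr => s _; rewrite Lcoef -hn mxE hornerM !horner_comp !horner_linp !mul1r.
  have -> : (n + (2 * m + s))%:R - m%:R = n%:R + (2 * m + s - m)%:R :> C.
    by rewrite !natrB ?natrD; [ring | lia].
  by rewrite mulrCA !mulrA.
transitivity (\sum_k (\sum_s lam 0 s *: P s i k).[n%:R] * Y n k 0).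
  under eq_bigr do rewrite mxE mulr_sumr.
  rewrite exchange_big; apply: eq_bigr => k _ /=.
  rewrite horner_sum mulr_suml; apply: eq_bigr => s _.
  by rewrite hornerZ !mxE /horner_eval mulrA.
by rewrite big1 // => k _; rewrite lamP horner0 mul0r.
Qed.

End ConstantRecurrence.

(** * Exponential polynomials and quasi-polynomials *)

(** Induction on the number of exponentials, then on the size of the last coefficient. Subtracting
    [be k] times the relation from its shift lowers the degree of [a k], while the other leading
    coefficients are only multiplied by [be i - be k]. *)
Lemma exp_poly_indep (C : numFieldType) k (be : nat -> C) (a : nat -> {poly C}) :
  (forall i, (i < k)%N -> be i != 0) ->
  (forall i j, (i < j)%N -> (j < k)%N -> be i != be j) ->
  eventually (fun n => \sum_(i < k) (a i).[n%:R] * be i ^+ n = 0) ->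
  forall i, (i < k)%N -> a i = 0.
Proof.
elim: k a => // k IHk a be0 bed.
have [s] := ubnP (size (a k)); elim: s a => // s IHs a sa h.
have IHk' (b : nat -> {poly C}) : eventually (fun n => \sum_(i < k) (b i).[n%:R] * be i ^+ n = 0) ->
    forall i, (i < k)%N -> b i = 0.
  apply: IHk => [i ik|i j ij jk]; first by apply: be0; lia.
  by apply: bed => //; lia.
suff low : forall i, (i < k)%N -> a i = 0.
  have ak : a k = 0.
    apply: poly_eventually_eq0; apply: eventually_imp h => n.
    rewrite big_ord_recr /= big1 ?add0r => [/eqP|i _]; last first.
      by rewrite low // horner0 mul0r.
    by rewrite mulf_eq0 expf_eq0 (negPf (be0 _ _)) // andbF orbF => /eqP.
  by move=> i; rewrite ltnS leq_eqVlt => /orP[/eqP->|/low].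
have [a0|ak0] := eqVneq (a k) 0.
  apply: IHk'; apply: eventually_imp h => n.
  by rewrite big_ord_recr /= a0 horner0 mul0r addr0.
pose sft (p : {poly C}) := p \Po linp 1 1.
have sz p : size (sft p) = size p by rewrite size_comp_poly2 ?size_linp ?oner_neq0.
have lc p : (sft p)`_(size p).-1 = lead_coef p.
  rewrite -[X in (_)`_(X).-1]sz -lead_coefE lead_coef_comp ?size_linp ?oner_neq0 //.
  by rewrite /linp scale1r lead_coefXaddC expr1n mulr1.
pose b i := be i *: sft (a i) - be k *: a i.
have hb : eventually (fun n => \sum_(i < k.+1) (b i).[n%:R] * be i ^+ n = 0).
  have h1 : eventually (fun n => \sum_(i < k.+1) (a i).[n.+1%:R] * be i ^+ n.+1 = 0).
    exact: (eventually_comp (phi := S)) h.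
  apply: eventually_imp (eventually_and h h1) => n [hn hn1].
  have e : \sum_(i < k.+1) (a i).[n.+1%:R] * be i ^+ n.+1
      - be k * \sum_(i < k.+1) (a i).[n%:R] * be i ^+ n = 0 by rewrite hn1 hn mulr0 subr0.
  rewrite -[RHS]e mulr_sumr -sumrB.
  apply: eq_bigr => i _; rewrite hornerD hornerN !hornerZ horner_comp horner_linp mul1r natr1.
  by rewrite exprS; ring.
have sb : (size (b k) < s)%N.
  have [bk0|bk0] := eqVneq (b k) 0; first by rewrite bk0 size_poly0; move: sa ak0; rewrite -size_poly_gt0; lia_size.
  suff : (size (b k) < size (a k))%N by move: sa; lia_size.
  have : (size (b k) <= size (a k))%N.
    apply: leq_trans (size_polyD _ _) _; rewrite geq_max size_polyN.
    by rewrite size_scale_leq (leq_trans (size_scale_leq _ _)) ?sz.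
  rewrite leq_eqVlt => /orP[/eqP e|//].
  case/negP: bk0; rewrite -lead_coef_eq0 lead_coefE e coefB !coefZ lc lead_coefE.
  by rewrite subrr.
have bz := IHs b sb hb; move=> i ik.
apply/eqP; rewrite -lead_coef_eq0; have /polyP/(_ (size (a i)).-1) := bz i (ltnW ik).
rewrite coef0 coefB !coefZ lc lead_coefE -mulrBl => /eqP; rewrite mulf_eq0 subr_eq0.
by rewrite (negPf (bed i k ik (ltnSn k))).
Qed.

(** The difference of [x^(e+1)] has leading term [(e+1) x^e]; a multiple of it removes the top term
    of [P], and the degree drops. *)
Lemma discrete_antiderivative (C : numFieldType) (P : {poly C}) :
  exists Q : {poly C}, forall x, Q.[x + 1] - Q.[x] = P.[x].
Proof.
have [s] := ubnP (size P); elim: s P => // s IH P sP.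
have [->|P0] := eqVneq P 0; first by exists 0 => x; rewrite !horner0 subrr.
pose e := (size P).-1; have sPe : size P = e.+1 by rewrite prednK // size_poly_gt0.
pose T : {poly C} := (1 + 'X) ^+ e.+1 - 'X ^+ e.+1.
have TE : T = \sum_(i < e.+1) 'X^i *+ 'C(e.+1, i).
  rewrite /T exprDn big_ord_recr /= subnn expr0 mul1r binn mulr1n addrK.
  by apply: eq_bigr => i _; rewrite expr1n mul1r.
have Tc i : T`_i = if (i < e.+1)%N then ('C(e.+1, i))%:R else 0.
  rewrite TE coef_sum; case: ltnP => ie.
    rewrite (bigD1 (Ordinal ie)) //= coefMn coefXn eqxx big1 ?addr0 // => j ji.
    by rewrite coefMn coefXn -val_eqE /= in ji *; rewrite eq_sym (negPf ji) mul0rn.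
  rewrite big1 // => j _; rewrite coefMn coefXn; case: eqP => [ij|]; last by rewrite mul0rn.
  by move: ie; rewrite ij leqNgt ltn_ord.
pose c := lead_coef P / (e.+1)%:R.
have [|Q hQ] := IH (P - c *: T).
  apply: leq_trans (_ : e.+1 <= s)%N; last by move: sP; rewrite sPe; lia.
  rewrite ltnS; apply/leq_sizeP => j ej; rewrite coefB coefZ Tc.
  have [je|je] := ltnP j e.+1; last by rewrite mulr0 subr0 nth_default // sPe.
  have -> : j = e by lia.
  by rewrite binSn /c divfK ?pnatr_eq0 // lead_coefE subrr.
exists (Q + c *: 'X ^+ e.+1) => x.
have := hQ x; rewrite hornerD hornerN hornerZ => h.
have -> : P.[x] = Q.[x + 1] - Q.[x] + c * T.[x] by rewrite h subrK.
rewrite /T !(hornerD, hornerN, hornerZ, horner_exp, hornerX, hornerC) [1 + x]addrC.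
by move: ((x + 1) ^+ e.+1) (x ^+ e.+1) => u v; ring.
Qed.

(** Each factor [X^N - 1] takes differences along the progression [N m + r], and is undone by a
    polynomial antiderivative. *)
Lemma quasi_polynomial (C : numFieldType) N D (h : nat -> C) :
  eventually (fun n => recop (('X^N - 1) ^+ D) h n = 0) ->
  forall r, exists P : {poly C}, eventually (fun m => h (N * m + r)%N = P.[m%:R]).
Proof.
case: N => [|N].
  (* For [N = 0] the index is constantly [r]. *)
  move=> _ r; exists (h r)%:P; exists 0%N => m _; by rewrite mul0n hornerC.
elim: D h => [|D IH] h.
  rewrite expr0 => [[n0 hn]] r; exists 0; exists n0 => m nm.
  by have := hn (N.+1 * m + r)%N; rewrite recopC mul1r horner0 => -> //; nia.
rewrite exprSr => hh r.
have [|P [m0 hP]] := IH (recop ('X^(N.+1) - 1) h) _ r.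
  by apply: eventually_imp hh => n; rewrite recopM.
have [Q hQ] := discrete_antiderivative P.
exists (Q + (h (N.+1 * m0 + r)%N - Q.[m0%:R])%:P), m0 => m.
move=> /subnK <-; elim: (m - m0)%N => [|k IHk].
  by rewrite add0n hornerD hornerC addrC subrK.
have := hP (k + m0)%N (leq_addl _ _); rewrite recopXnsub1 => /eqP; rewrite subr_eq => /eqP.
rewrite (_ : N.+1 * (k + m0) + r + N.+1 = N.+1 * (k.+1 + m0) + r)%N; last by lia.
by move=> ->; rewrite IHk addSn -natr1 -hQ !hornerD !hornerC; ring.
Qed.

(** * Spans of germs over the rational functions *)

Section Spans.
Variables (C : numFieldType) (d : nat) (Y : nat -> 'cV[C]_d).

Lemma vspanD w w' : vspan Y w -> vspan Y w' -> vspan Y (fun n => w n + w' n).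
Proof.
move=> [D [a [D0 h]]] [D' [a' [D0' h']]]; exists (D * D'), (D' *: a + D *: a').
rewrite mulf_neq0 //; split=> //.
apply: eventually_imp (eventually_and h h') => n [hn hn'].
rewrite /evm map_mxD -!/(evm _ _) mulmxDl !evm_scale -!scalemxAl -hn -hn'.
by rewrite raddfD /= scalerDr hornerM !scalerA [D'.[_] * _]mulrC.
Qed.

Lemma vspan_poly p w : vspan Y w -> vspan Y (fun n => p.[n%:R] * w n).
Proof.
move=> [D [a [D0 h]]]; exists D, (p *: a); split=> //; apply: eventually_imp h => n hn.
by rewrite evm_scale -scalemxAl -hn !scale_scalar_mx mulrCA.
Qed.

Lemma vspan0 : vspan Y (fun=> 0).
Proof.
exists 1, 0; rewrite oner_neq0; split=> //; exists 0%N => n _.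
by rewrite /evm map_mx0 mul0mx raddf0 scaler0.
Qed.

Lemma vspan_eventually w w' : eventually (fun n => w n = w' n) -> vspan Y w -> vspan Y w'.
Proof.
move=> e [D [a [D0 h]]]; exists D, a; split=> //.
by apply: eventually_imp (eventually_and e h) => n [<-].
Qed.

Lemma vspan_sum k (w : nat -> nat -> C) : (forall j, (j < k)%N -> vspan Y (w j)) ->
  vspan Y (fun n => \sum_(j < k) w j n).
Proof.
elim: k => [|k IH] h.
  by apply: vspan_eventually vspan0; exists 0%N => n _; rewrite big_ord0.
have := vspanD (IH (fun j jk => h j (ltnW jk))) (h k (ltnSn k)).
by apply: vspan_eventually; exists 0%N => n _; rewrite big_ord_recr.
Qed.

Lemma act_vspan_entry k (R : 'M_(k, d)) Z i : act R Y Z -> vspan Y (fun n => Z n i 0).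
Proof.
move=> [D [P [D0 RE h]]]; exists D, (row i P); split=> //; apply: eventually_imp h => n hn.
apply/matrixP => x y; rewrite !ord1 /evm map_row -/(evm n P) -row_mul -hn !mxE.
by rewrite eqxx mulr1n.
Qed.

Lemma vspan_dilate q (B : 'M_d) w : (0 < q)%N -> act B Y (fun n => Y (q * n)%N) ->
  vspan Y w -> vspan Y (fun n => w (q * n)%N).
Proof.
move=> qp aB [D [a [D0 h]]].
have q0 : q%:R != 0 :> C by rewrite pnatr_eq0 -lt0n.
apply: (act_vspan (D := D \Po linp q%:R 0) (b := map_mx (comp_poly (linp q%:R 0)) a) aB).
  exact: comp_linp_neq0.
have hq n : (n <= q * n)%N by nia.
apply: eventually_imp (eventually_comp hq h) => n.
rewrite horner_comp horner_linp addr0 -natrM => ->; congr (_ *m _).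
by apply/matrixP => i i'; rewrite !mxE /horner_eval horner_comp horner_linp addr0 -natrM.
Qed.

End Spans.

(** * Spanned functions are rational on a progression *)

Section QuasiPolynomial.
Variables (C : numClosedFieldType) (d q : nat) (Y : nat -> 'cV[C]_d).
Variables A B : 'M[{fraction {poly C}}]_d.
Hypothesis q_gt1 : (1 < q)%N.
Hypothesis Yindep : vindep Y.
Hypothesis actA : act A Y (fun n => Y n.+1).
Hypothesis actB : act B Y (fun n => Y (q * n)%N).
Hypothesis unitA : A \in unitmx.
Hypothesis unitB : B \in unitmx.

(** Dilation stability puts every [al^(q^k n)] in the span. Among [d + 1] of them there is a
    relation, so by [exp_poly_indep] two bases coincide. *)
Lemma exponent_root_of_unity al : al != 0 -> vspan Y (fun n => al ^+ n) ->
  exists2 N, (0 < N)%N & al ^+ N = 1.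
Proof.
move=> al0 h; pose be k := al ^+ (q ^ k).
have hk k : vspan Y (fun n => be k ^+ n).
  elim: k => [|k IH]; first by rewrite /be expn0 expr1.
  apply: vspan_eventually (vspan_dilate _ actB IH); last by lia.
  by exists 0%N => n _; rewrite /be -!exprM expnS mulnA [(q * _)%N]mulnC.
pose W n : 'cV[C]_d.+1 := \col_k be k ^+ n.
have [R aR] : exists R, act R Y W.
  apply: act_exists => i; apply: vspan_eventually (hk i).
  by exists 0%N => n _; rewrite mxE.
apply: contrapT => noN; apply: (act_dep aR (ltnSn d)) => a ha.
apply/rowP => i; rewrite mxE.
have -> : a 0 i = a 0 (inord (val i)) by rewrite inord_val.
apply: (@exp_poly_indep C d.+1 be (fun i => a 0 (inord i))) => //.
- by move=> k _; rewrite expf_neq0.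
- move=> j k jk _; apply/negP => /eqP e; apply: noN; exists (q ^ k - q ^ j)%N.
    by rewrite subn_gt0 ltn_exp2l.
  have qj : al ^+ (q ^ j) != 0 by rewrite expf_neq0.
  by apply: (mulIf qj); rewrite -exprD subnK ?mul1r // leq_exp2l // ltnW.
- apply: eventually_imp ha => n /matrixP/(_ 0 0); rewrite !mxE => e; rewrite -[RHS]e.
  by apply: eq_bigr => k _; rewrite !mxE inord_val.
- exact: ltn_ord.
Qed.

Lemma vspan_quasi_polynomial w : vspan Y w ->
  exists (N : nat) (D P : {poly C}), [/\ (0 < N)%N, D != 0
    & eventually (fun m => D.[m%:R] * w (N * m)%N = P.[m%:R])].
Proof.
move=> hw.
have [c [L0 [c0 L00 hL0]]] := constant_recurrence q_gt1 Yindep actA actB unitA unitB.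
pose h i n := c.[n%:R] * Y n i 0.
(* An operator [Om] of least size annihilating all [c * Y_i] is taken: minimality forces every root
   of [Om] to occur as an exponential in the span. *)
pose annih (L : {poly C}) := L != 0 /\ forall i, eventually (fun n => recop L (h i) n = 0).
have ex : exists s, `[< exists2 L, annih L & size L = s >].
  by exists (size L0); apply/asboolP; exists L0.
case: (ex_minnP ex) => s /asboolP[Om [Om0 hOm] sOm] smin.
have {}smin L : annih L -> (s <= size L)%N by move=> hL; apply: smin; apply/asboolP; exists L.
have rootOm al : root Om al -> exists2 N, (0 < N)%N & al ^+ N = 1.
  case/factor_theorem=> Om' OmE.
  have Om'0 : Om' != 0 by apply: contraNneq Om0 => e; rewrite OmE e mul0r.
  have sOm' : (size Om' < s)%N by rewrite -sOm OmE size_mul ?polyXsubC_eq0 // size_XsubC addn2.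
  have [i hi] : exists i, ~ eventually (fun n => recop Om' (h i) n = 0).
    apply: contrapT => hn; have := smin Om'; rewrite leqNgt sOm' => /(_ _)/negP; apply=> //.
    by split=> // i; apply: contrapT => hi; apply: hn; exists i.
  (* With [Om = Om' (X - al)], this [v] is a nonzero germ in the span with [v(n + 1) = al v(n)],
     hence a multiple of [al^n]. *)
  pose v := recop Om' (h i).
  have [n0 hv] : eventually (fun n => v n.+1 = al * v n).
    apply: eventually_imp (hOm i) => n; rewrite OmE mulrC recopM recopXsubC => /eqP.
    by rewrite subr_eq0 => /eqP.
  have vE n : (n0 <= n)%N -> v n = al ^+ (n - n0) * v n0.
    move=> /subnK <-; elim: (n - n0)%N => [|k IH]; first by rewrite add0n subnn mul1r.
    by rewrite addSn hv ?leq_addl // IH -addSn !addnK exprS mulrA.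
  have vn0 : v n0 != 0.
    by apply/negP => /eqP e; apply: hi; exists n0 => n /vE; rewrite e mulr0.
  have al0 : al != 0.
    apply/negP => /eqP e; apply: hi; exists n0.+1 => n nn; rewrite -/(v n) vE; last by lia.
    by rewrite e expr0n subn_eq0 leqNgt nn mul0r.
  apply: exponent_root_of_unity => //.
  have : vspan Y v.
    apply: (@vspan_sum _ _ Y _ (fun j n => Om'`_j * h i (n + j)%N)) => j _.
    have hj : vspan Y (fun n => h i (n + j)%N).
      apply: vspan_eventually (vspan_poly (c \Po linp 1 j%:R) (act_vspan_entry i (act_shiftmx actA j))).
      by exists 0%N => n _; rewrite horner_comp horner_linp mul1r -natrD.
    apply: vspan_eventually (vspan_poly (Om'`_j)%:P hj).
    by exists 0%N => n _; rewrite hornerC.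
  move=> /(vspan_poly (al ^+ n0 / v n0)%:P); apply: vspan_eventually; exists n0 => n nn.
  by rewrite hornerC (vE n nn) [X in _ * X]mulrC mulrA divfK // -exprD subnKC.
have [rs OmE] := closed_field_poly_normal Om.
have rsroot al : al \in rs -> root Om al.
  by move=> ain; rewrite OmE rootZ ?lead_coef_eq0 // root_prod_XsubC.
have [N Np hN] : exists2 N, (0 < N)%N & forall al, al \in rs -> al ^+ N = 1.
  have : forall al, al \in rs -> exists2 N, (0 < N)%N & al ^+ N = 1 by move=> al /rsroot/rootOm.
  elim: (rs) => [|al l IH] hl; first by exists 1.
  have [N Np hN] := IH (fun b bl => hl b (mem_behead (s := al :: l) bl)).
  have [M Mp hM] := hl al (mem_head _ _).
  exists (M * N)%N => [|b]; first by rewrite muln_gt0 Mp.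
  rewrite inE => /orP[/eqP->|/hN bN]; first by rewrite exprM hM expr1n.
  by rewrite mulnC exprM bN expr1n.
(* All roots are [N]-th roots of unity, so [Om] divides a power of [X^N - 1], which then annihilates
   each [h i]. *)
have [M ME] : exists M, ('X^N - 1) ^+ size rs = M * Om.
  have [M ME] : exists M, ('X^N - 1) ^+ size rs = M * \prod_(z <- rs) ('X - z%:P).
    elim: (rs) hN => [|al l IH] hl; first by exists 1; rewrite big_nil mulr1 expr0.
    have [M ME] := IH (fun b bl => hl b (mem_behead (s := al :: l) bl)).
    have /factor_theorem[R RE] : root ('X^N - 1) al.
      by rewrite rootE hornerD hornerN hornerC hornerXn hl ?mem_head // subrr.
    by exists (M * R); rewrite big_cons /= exprSr ME {1}RE; ring.
  exists ((lead_coef Om)^-1 *: M); rewrite ME {2}OmE -scalerAl -scalerAr scalerA mulVf ?scale1r //.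
  by rewrite lead_coef_eq0.
have hq i : exists P : {poly C}, eventually (fun m => h i (N * m)%N = P.[m%:R]).
  have [|P hP] := quasi_polynomial (N := N) (D := size rs) (h := h i) _ 0.
    by rewrite ME; apply: recop_dvd; exact: hOm.
  by exists P; apply: eventually_imp hP => m; rewrite addn0.
have {hq} /choice[P hP] := hq.
have [D [a [D0 ha]]] := hw.
have N0 : N%:R != 0 :> C by rewrite pnatr_eq0 -lt0n.
pose sN (p : {poly C}) := p \Po linp N%:R 0.
have sNE p m : (sN p).[m%:R] = p.[(N * m)%:R] by rewrite horner_comp horner_linp addr0 natrM.
exists N, (sN (D * c)), (\sum_i sN (a 0 i) * P i); split=> //.
  by rewrite comp_linp_neq0 // mulf_neq0.
have hNm m : (m <= N * m)%N by nia.
apply: eventually_imp (eventually_and (eventually_comp hNm ha) (eventually_all hP)) => m [h1 h2].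
have /matrixP/(_ 0 0) := h1; rewrite !mxE eqxx mulr1n => h3.
rewrite sNE hornerM mulrAC h3 horner_sum mulr_suml; apply: eq_bigr => i _.
by rewrite hornerM sNE -h2 /h !mxE /horner_eval; ring.
Qed.

End QuasiPolynomial.

(** * Multiplicative functions satisfying polynomial recurrences *)

Section IndependenceTransfer.
Variables (C : numFieldType) (d : nat).
Implicit Types Y : nat -> 'cV[C]_d.

Lemma map_comp_linp_eq0 b a (v : 'rV[{poly C}]_d) : b != 0 ->
  map_mx (comp_poly (linp b a)) v = 0 -> v = 0.
Proof.
move=> b0 /rowP h; apply/rowP => i; have := h i; rewrite !mxE => /eqP.
by rewrite comp_poly2_eq0 ?size_linp // => /eqP.
Qed.

Lemma vindep_dilate q Y : (0 < q)%N -> vindep (fun n => Y (q * n)%N) -> vindep Y.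
Proof.
move=> qp iY a h; have q0 : q%:R != 0 :> C by rewrite pnatr_eq0 -lt0n.
apply: (map_comp_linp_eq0 (b := q%:R) (a := 0)) => //; apply: iY.
have hq n : (n <= q * n)%N by nia.
apply: eventually_imp (eventually_comp hq h) => n <-; congr (_ *m _).
by apply/matrixP => i i'; rewrite !mxE /horner_eval horner_comp horner_linp addr0 -natrM.
Qed.

Lemma vindep_shift Y : vindep Y -> vindep (fun n => Y n.+1).
Proof.
move=> iY a [n0 h].
apply: (map_comp_linp_eq0 (b := 1) (a := - 1)); first exact: oner_neq0.
apply: iY; exists n0.+1 => -[//|n] nn; rewrite -(h n nn); congr (_ *m _).
apply/matrixP => i i'; rewrite !mxE /horner_eval horner_comp horner_linp mul1r.
by rewrite -natr1 addrK.
Qed.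

Lemma vspan_div D Y w : D != 0 -> vspan Y (fun n => D.[n%:R] * w n) -> vspan Y w.
Proof.
move=> D0 [E [a [E0 h]]]; exists (E * D), a; rewrite mulf_neq0 //; split=> //.
by apply: eventually_imp h => n <-; rewrite hornerM -scale_scalar_mx scalerA.
Qed.

End IndependenceTransfer.

(** * The space spanned by the functions [f(q^l x + j)] *)

Section Basis.
Variables (C : numClosedFieldType) (f : nat -> C) (q r : nat) (P : nat -> {poly C}).
Hypothesis q_gt1 : (1 < q)%N.
Hypothesis f_mul : forall i x, (0 < x)%N -> coprime q x -> f (q ^ i * x) = f (q ^ i)%N * f x.
Hypothesis f_pow : forall i, f (q ^ i)%N != 0.
Hypothesis Pr_neq0 : P r != 0.
Hypothesis f_rec : eventually (fun n => \sum_(s < r.+1) (P s).[n%:R] * f (n + s)%N = 0).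

Definition gfun l j n := f (q ^ l * n + j)%N.

Definition gcol (idx : nat -> nat * nat) d n : 'cV[C]_d :=
  \col_(i < d) gfun (idx i).1 (idx i).2 n.

(** The rank over [C(x)] of the functions of level at least [m], with [j] prime to [q], is at least
    [d]. *)
Definition independent_at m d := exists idx,
  (forall i, (i < d)%N -> (m <= (idx i).1)%N /\ coprime q (idx i).2) /\ vindep (gcol idx d).

Lemma independent_at_leq m m' d : (m' <= m)%N -> independent_at m d -> independent_at m' d.
Proof.
move=> mm [idx [h ind]]; exists idx; split=> // i id.
by have [mi co] := h i id; split=> //; exact: leq_trans mi.
Qed.

Lemma coprime_pos j : coprime q j -> (0 < j)%N.
Proof. by case: j => //; rewrite /coprime gcdn0; lia. Qed.

Lemma coprime_gfun l j n : (0 < l)%N -> coprime q j -> coprime q (q ^ l * n + j).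
Proof.
case: l => // l _ co; rewrite /coprime expnS -mulnA mulnC gcdnMDl //.
Qed.

(** The recurrence at [q^k n + j - r] expresses the function of offset [j] by those of the [r]
    preceding offsets, since [P r] is nonzero. *)
Lemma vspan_window k j : vspan (fun n => \col_(i < r) gfun k i n) (gfun k j).
Proof.
elim/ltn_ind: j => j IH; have [jr|rj] := ltnP j r.
  apply: vspan_eventually (act_vspan_entry (Ordinal jr) (act_id _)).
  by exists 0%N => n _; rewrite mxE.
have qk0 : (q ^ k)%:R != 0 :> C := natr_expn_neq0 C k q_gt1.
have qk n : (n <= q ^ k * n + (j - r))%N.
  by have : (0 < q ^ k)%N; [rewrite expn_gt0; lia | nia].
apply: (@vspan_div _ _ (P r \Po linp (q ^ k)%:R (j - r)%:R)); first exact: comp_linp_neq0.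
have h s : (s < r)%N -> vspan (fun n => \col_(i < r) gfun k i n)
    (fun n => (- (P s \Po linp (q ^ k)%:R (j - r)%:R)).[n%:R] * gfun k (j - r + s) n).
  by move=> sr; apply: vspan_poly; apply: IH; lia.
apply: vspan_eventually (vspan_sum h).
apply: eventually_imp (eventually_comp qk f_rec) => n.
rewrite big_ord_recr /= -addnA subnK // addrC => /eqP; rewrite addr_eq0 => /eqP.
rewrite horner_comp horner_linp -natrM -natrD /gfun => ->.
rewrite -sumrN; apply: eq_bigr => s _.
by rewrite hornerN horner_comp horner_linp -natrM -natrD mulNr addnA.
Qed.

(** By [f(q^k x + q^(k-l) j) = f(q^(k-l)) f(q^l x + j)] all functions are raised to one level [k],
    where a window of length [r] spans. Level at least 1 ensures that [q^l x + j] is prime to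
    [q]. *)
Lemma independent_at_bound d : independent_at 1 d -> (d <= r)%N.
Proof.
move=> [idx [h ind]]; rewrite leqNgt; apply/negP => rd.
pose k := \max_(i < d) (idx i).1.
have [R aR] : exists R, act R (fun n => \col_(i < r) gfun k i n) (gcol idx d).
  apply: act_exists => i; have [l1 co] := h i (ltn_ord i).
  have lk : ((idx i).1 <= k)%N := leq_bigmax i.
  apply: vspan_eventually (vspan_poly (f (q ^ (k - (idx i).1))%N)^-1%:P
    (vspan_window k (q ^ (k - (idx i).1) * (idx i).2)%N)).
  exists 0%N => n _; rewrite mxE hornerC /gfun.
  have e : (q ^ k * n + q ^ (k - (idx i).1) * (idx i).2 =
      q ^ (k - (idx i).1) * (q ^ (idx i).1 * n + (idx i).2))%N.
    by rewrite mulnDr mulnA -expnD subnK.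
  rewrite e f_mul ?mulKf //; first by rewrite addn_gt0 (coprime_pos co) orbT.
  exact: coprime_gfun.
exact: (act_dep aR rd ind).
Qed.

Lemma independent_at0 m : independent_at m 0.
Proof. by exists (fun=> (0, 0)%N); split=> // a _; exact: thinmx0. Qed.

(** The rank is nonincreasing in the level and bounded by [r], hence eventually constant. *)
Lemma maximal_rank : exists d m,
  [/\ (0 < m)%N, forall m', independent_at m' d & ~ independent_at m d.+1].
Proof.
have [d hd nd] : exists2 d, forall m, independent_at m d
    & ~ forall m, independent_at m d.+1.
  apply: contrapT => no.
  have all_d d : forall m, independent_at m d.
    elim: d => [|d IH]; first exact: independent_at0.
    by apply: contrapT => nd; apply: no; exists d.
  by have := independent_at_bound (all_d r.+1 1%N); rewrite ltnn.
have [m nm] : exists m, ~ independent_at m d.+1.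
  by apply: contrapT => no; apply: nd => m; apply: contrapT => nm; apply: no; exists m.
exists d, m.+1; split; [by [] | exact: hd | move=> h; apply: nm].
exact: independent_at_leq (leqnSn m) h.
Qed.

(** Adjoining one more function creates a relation; its coefficient there is nonzero because the
    first [d] functions are independent. *)
Lemma vspan_maximal idx d m l j :
  (forall i, (i < d)%N -> (m <= (idx i).1)%N /\ coprime q (idx i).2) ->
  vindep (gcol idx d) -> ~ independent_at m d.+1 -> (m <= l)%N -> coprime q j ->
  vspan (gcol idx d) (gfun l j).
Proof.
move=> h ind nind ml co.
pose idx' i := if (i < d)%N then idx i else (l, j).
have [a [a0 ha]] : exists a : 'rV[{poly C}]_d.+1, a != 0 /\
    eventually (fun n => evm n a *m gcol idx' d.+1 n = 0).
  apply: contrapT => no; apply: nind; exists idx'; split.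
    move=> i _; rewrite /idx'; case: ifP => [/h //|_]; by split.
  move=> a ha; apply/eqP; apply: contrapT => /negP a0; apply: no; by exists a.
pose b : 'rV_d := \row_i a 0 (widen_ord (leqnSn d) i).
have ha' : eventually (fun n => evm n b *m gcol idx d n = - ((a 0 ord_max).[n%:R] *: (gfun l j n)%:M)).
  apply: eventually_imp ha => n /matrixP/(_ 0 0); rewrite !mxE big_ord_recr /= => /eqP.
  rewrite addr_eq0 => /eqP e; apply/matrixP => x y; rewrite !ord1 !mxE eqxx mulr1n.
  move: e; rewrite !mxE /idx' /= ltnn /= /horner_eval => <-.
  by apply: eq_bigr => i _; rewrite !mxE /= ltn_ord /horner_eval.
have am0 : a 0 ord_max != 0.
  apply: contraNneq a0 => am0; apply/eqP.
  have b0 : b = 0.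
    apply: ind; apply: eventually_imp ha' => n ->.
    by rewrite am0 horner0 scale0r oppr0.
  apply/rowP => i; rewrite mxE; case: (unliftP ord_max i) => [i' ->|-> //].
  have /rowP/(_ i') := b0; rewrite !mxE => e; rewrite -[RHS]e; congr (a 0 _).
  by apply: val_inj; rewrite /= /bump leqNgt ltn_ord.
exists (a 0 ord_max), (- b); split=> //; apply: eventually_imp ha' => n.
by rewrite /evm map_mxN mulNmx -/(evm n b) => ->; rewrite opprK.
Qed.

Theorem rational_on_progression : exists (N : nat) (D Q : {poly C}),
  [/\ (0 < N)%N, D != 0 & eventually (fun m => D.[m%:R] * f (N * m + 1)%N = Q.[m%:R])].
Proof.
have [d [m [m0 /(_ m.+1) [idx1 [h1 ind1]] nind]]] := maximal_rank.
(* A family independent at level [m + 1] is lowered by one level. Dilation by [q] leads back to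
   [idx1]: this makes [idx] independent and [B] invertible. *)
pose idx i := ((idx1 i).1.-1, (idx1 i).2).
have h i : (i < d)%N -> (m <= (idx i).1)%N /\ coprime q (idx i).2.
  by move=> /h1 [mi co]; split=> //=; lia.
have YE n : gcol idx d (q * n)%N = gcol idx1 d n.
  apply/matrixP => i j; rewrite !mxE /gfun /=; have [mi _] := h1 i (ltn_ord i).
  by rewrite mulnA -expnSr prednK //; lia.
have indq : vindep (fun n => gcol idx d (q * n)%N).
  by move=> a ha; apply: ind1; apply: eventually_imp ha => n; rewrite YE.
have qp : (0 < q)%N by lia.
have ind := vindep_dilate qp indq.
have [A aA] : exists A, act A (gcol idx d) (fun n => gcol idx d n.+1).
  apply: act_exists => i; have [mi co] := h i (ltn_ord i).
  apply: vspan_eventually (vspan_maximal (l := (idx i).1) (j := q ^ (idx i).1 + (idx i).2) h ind nind mi _).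
    by exists 0%N => n _; rewrite mxE /gfun mulnS addnA [(_ * n + _)%N]addnC.
  by have := @coprime_gfun (idx i).1 (idx i).2 1 (leq_trans m0 mi) co; rewrite muln1.
have [B aB] : exists B, act B (gcol idx d) (fun n => gcol idx d (q * n)%N).
  apply: act_exists => i; have [mi co] := h i (ltn_ord i).
  apply: vspan_eventually (vspan_maximal (l := (idx i).1.+1) h ind nind (leqW mi) co).
  by exists 0%N => n _; rewrite mxE /gfun expnSr mulnA.
have uA : A \in unitmx by rewrite -row_free_unit; exact: act_row_free aA (vindep_shift ind).
have uB : B \in unitmx by rewrite -row_free_unit; exact: act_row_free aB indq.
have sp := vspan_maximal h ind nind (leqnn m) (coprimen1 q).
have [N [D [Q [Np D0 hN]]]] := vspan_quasi_polynomial q_gt1 ind aA aB uA uB sp.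
exists (q ^ m * N)%N, D, Q; split=> //; first by rewrite muln_gt0 Np expn_gt0 qp.
by apply: eventually_imp hN => n; rewrite /gfun mulnA.
Qed.

End Basis.

Lemma order_at_zero (R : fieldType) (p : {poly R}) : p != 0 ->
  exists a p1, p = p1 * 'X^a /\ p1.[0] != 0.
Proof.
move=> p0; have [a [p1 hp ->]] := multiplicity_XsubC p 0; exists a, p1.
by rewrite subr0; split=> //; move: hp; rewrite p0.
Qed.

(* Compare lowest coefficients: [a] and [b] are the orders of [Q] and [D] at zero. *)
Lemma scaling_identity (R : fieldType) (D Q : {poly R}) :
  D != 0 -> Q != 0 -> exists a b, forall n y : R, n != 0 ->
  y *: ((D \Po (n *: 'X)) * Q) = (Q \Po (n *: 'X)) * D -> y * n ^+ b = n ^+ a.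
Proof.
move=> /order_at_zero[b [D1 [DE D10]]] /order_at_zero[a [Q1 [QE Q10]]].
exists a, b => n y n0.
have compX c : 'X^c \Po (n *: 'X) = n ^+ c *: 'X^c by rewrite comp_Xn_poly exprZn.
rewrite DE QE !rmorphM /= !compX => e.
have Xab : 'X^(a + b) != 0 :> {poly R} by rewrite expf_neq0 ?polyX_eq0.
have {}e : (y * n ^+ b) *: ((D1 \Po (n *: 'X)) * Q1) = n ^+ a *: ((Q1 \Po (n *: 'X)) * D1).
  apply: (mulIf Xab); rewrite exprD.
  transitivity (y *: ((D1 \Po n *: 'X) * (n ^+ b *: 'X^b) * (Q1 * 'X^a))).
    by rewrite -!mul_polyC polyCM; ring.
  by rewrite e -!mul_polyC; ring.
have := congr1 (fun u => u.[0]) e.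
rewrite !hornerZ !hornerM !horner_comp !hornerZ hornerX mulr0 [Q1.[0] * _]mulrC.
by apply: mulIf; rewrite mulf_neq0.
Qed.

Lemma poly_eq0_on_progression (R : numFieldType) (Z : {poly R}) M n : (0 < M)%N ->
  eventually (fun m => Z.[(n + M * m)%:R] = 0) -> Z = 0.
Proof.
move=> Mp h; have M0 : M%:R != 0 :> R by rewrite pnatr_eq0 -lt0n.
have /eqP : Z \Po linp M%:R n%:R = 0.
  apply: poly_eventually_eq0; apply: eventually_imp h => m <-.
  by rewrite horner_comp horner_linp -natrM -natrD addnC.
by rewrite comp_poly2_eq0 ?size_linp // => /eqP.
Qed.

(** * Rational-valued multiplicative functions: powers on a progression *)

Section Multiplicative.
Variables (f : nat -> rat) (r : nat) (P : nat -> {poly rat}).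
Hypothesis f_mul : multiplicative_fun f.
Hypothesis f_nz : ~ eventually_zero f.
Hypothesis Pr_neq0 : P r != 0.
Hypothesis f_rec : eventually (fun n => \sum_(s < r.+1) (P s).[n%:R] * f (n + s)%N = 0).

Lemma multiplicative_at1 : f 1%N = 1.
Proof.
have /eqP := f_mul (ltn0Sn 0) (ltn0Sn 0) (coprimen1 1).
rewrite mul1n -{1}[f 1%N]mulr1 -subr_eq0 -mulrBr mulf_eq0 subr_eq0 => /orP[|/eqP //].
move=> /eqP f10; case: f_nz; exists 0%N => n n0.
by rewrite -[n]muln1 f_mul ?coprimen1 // f10 mulr0.
Qed.

(** Beyond the zeros of [P r], a run of [r] zeros propagates through the recurrence. *)
Lemma zero_window : (forall n0, exists2 n, (n0 <= n)%N & forall i, (i < r)%N -> f (n + i)%N = 0) ->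
  eventually_zero f.
Proof.
move=> h; have [n0 hn] := eventually_and f_rec (poly_eventually_neq0 Pr_neq0).
have [n nn hz] := h n0.
have all0 k : f (n + k)%N = 0.
  elim/ltn_ind: k => k IH; have [/hz //|rk] := ltnP k r.
  have [|e Pn] := hn (n + (k - r))%N; first by lia.
  move: e; rewrite big_ord_recr /= big1 ?add0r => [/eqP|s _].
    by rewrite mulf_eq0 (negPf Pn) -addnA subnK //= => /eqP.
  by rewrite -addnA IH ?mulr0 //; have := ltn_ord s; lia.
by exists n => m nm; rewrite -(subnKC (ltnW nm)).
Qed.

(** If every large prime [q] had some [f(q^a) = 0], the Chinese remainder theorem would give
    arbitrarily far [r] consecutive integers, each divisible exactly by such a [q^a]; this
    contradicts [zero_window]. *)
Lemma good_prime B : exists q, [/\ prime q, (B < q)%N & forall i, f (q ^ i)%N != 0].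
Proof.
apply: contrapT => no; apply: f_nz; apply: zero_window.
have bad q : prime q -> (B < q)%N -> exists i, f (q ^ i)%N = 0.
  move=> pq Bq; apply: contrapT => nz; apply: no; exists q; split=> // i.
  by apply/negP => /eqP fi; apply: nz; exists i.
have win k : exists M x, (0 < M)%N /\
    forall n, n = x %[mod M] -> forall i, (i < k)%N -> f (n + i)%N = 0.
  elim: k => [|k [M [x [Mp hx]]]]; first by exists 1, 0.
  have [q Mq pq] := prime_above (maxn B M); have [|a fa] := bad q pq; first by lia.
  have a0 : (0 < a)%N by case: a fa => //; rewrite expn0 multiplicative_at1 => /eqP; rewrite oner_eq0.
  have q1 := prime_gt1 pq.
  have qa : (0 < q ^ a.+1)%N by rewrite expn_gt0 prime_gt0.
  have co : coprime M (q ^ a.+1).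
    by rewrite coprimeXr // coprime_sym prime_coprime // gtnNdvd //; lia.
  (* A natural number congruent to [q^a - k] modulo [q^(a+1)], so that [q^a] divides [n + k]
     exactly. *)
  pose y := (q ^ a + q ^ a.+1 * k - k)%N.
  exists (M * q ^ a.+1)%N, (chinese M (q ^ a.+1) x y).
  split=> [|n hn i]; first by rewrite muln_gt0 Mp.
  have hn1 : n = x %[mod M].
    by rewrite -(chinese_modl co x y) -(modn_dvdm n (dvdn_mulr (q ^ a.+1) (dvdnn M))) hn modn_dvdm ?dvdn_mulr.
  have hn2 : n = y %[mod q ^ a.+1].
    by rewrite -(chinese_modr co x y) -(modn_dvdm n (dvdn_mull M (dvdnn (q ^ a.+1)))) hn modn_dvdm ?dvdn_mull.
  rewrite ltnS leq_eqVlt => /orP[/eqP ->|]; last exact: hx.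
  have e : ((n + k) %% q ^ a.+1 = q ^ a)%N.
    rewrite -modnDml hn2 modnDml /y subnK; last first.
      by rewrite (leq_trans _ (leq_addl _ _)) // leq_pmull.
    by rewrite addnC mulnC modnMDl modn_small // ltn_exp2l.
  rewrite (divn_eq (n + k) (q ^ a.+1)) e expnS mulnA -mulSnr mulnC.
  rewrite f_mul ?fa ?mul0r ?expn_gt0 ?(prime_gt0 pq) //.
  by apply: coprimeXl; rewrite prime_coprime // -addn1 dvdn_addr ?dvdn_mull // dvdn1 neq_ltn q1 orbT.
move=> n0; have [M [x [Mp hx]]] := win r; exists (n0 * M + x)%N; first by nia.
by apply: hx; rewrite modnMDl.
Qed.

(** Let [f = R] with [R] rational on [1] modulo [N]. For [n] and [x] there with [x] prime to [n],
    [f(n) R(x) = R(n x)]; infinitely many such [x] make this an identity in [x], and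
    [scaling_identity] evaluates [f(n)]. *)
Lemma power_on_progression : exists (N a b : nat), (0 < N)%N /\
  forall m, f (N * m + 1)%N * (N * m + 1)%:R ^+ b = (N * m + 1)%:R ^+ a.
Proof.
have [q [pq _ fq]] := good_prime 0.
pose fC n : algC := ratr (f n).
have [N [D [Q [Np D0 hDQ]]]] : exists (N : nat) (D Q : {poly algC}), [/\ (0 < N)%N, D != 0
    & eventually (fun m => D.[m%:R] * fC (N * m + 1)%N = Q.[m%:R])].
  apply: (@rational_on_progression _ fC q r (fun s => map_poly ratr (P s))).
  - exact: prime_gt1.
  - move=> i x x0 co; rewrite /fC f_mul ?rmorphM ?expn_gt0 ?(prime_gt0 pq) //.
    exact: coprimeXl.
  - by move=> i; rewrite fmorph_eq0.
  - by rewrite map_poly_eq0.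
  - apply: eventually_imp f_rec => n hn; have := congr1 (fun x => ratr x : algC) hn.
    rewrite rmorph0 rmorph_sum /= => e; rewrite -[RHS]e; apply: eq_bigr => s _.
    by rewrite rmorphM /= -horner_map /= ratr_nat.
(* Large powers of a good prime [l > N], with exponent a multiple of [totient N], are [1] modulo
   [N], and [f] does not vanish there. *)
have Q0 : Q != 0.
  apply/negP => /eqP Q0.
  have [m0 hm] := eventually_and hDQ (poly_eventually_neq0 D0).
  have [l [pl Nl fl]] := good_prime N.
  have co : coprime l N by rewrite prime_coprime // gtnNdvd.
  pose x := (l ^ (totient N * (N * m0 + N)))%N.
  have tN : (0 < totient N)%N by rewrite totient_gt0.
  have x1 : x = 1 %[mod N] by rewrite /x expnM -modnXm Euler_exp_totient // modnXm exp1n.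
  have xbig : (N * m0 + N < x)%N.
    apply: leq_trans (_ : l ^ (N * m0 + N) <= _)%N; first by apply: ltn_expl; exact: prime_gt1.
    by rewrite leq_exp2l ?prime_gt1 // leq_pmull.
  have /dvdnP[m xm] : (N %| x - 1)%N by rewrite -eqn_mod_dvd ?x1 //; lia.
  have xE : x = (N * m + 1)%N by rewrite mulnC -xm subnK //; lia.
  have [|e Dm] := hm m; first by rewrite -(leq_pmul2l Np); lia.
  move: e; rewrite Q0 horner0 -xE => /eqP; rewrite mulf_eq0 (negPf Dm) /= fmorph_eq0.
  by rewrite (negPf (fl _)).
have N0 : N%:R != 0 :> algC by rewrite pnatr_eq0 -lt0n.
(* The change of variable [x = N m + 1], so that the rational function is read at the argument of
   [f]. *)
pose hat (p : {poly algC}) := p \Po linp N%:R^-1 (- N%:R^-1).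
have hatE p m : (hat p).[(N * m + 1)%:R] = p.[m%:R].
  rewrite horner_comp horner_linp; congr (_.[_]).
  by rewrite natrD natrM mulrDr mulKf // mulr1 addrK.
have hat0 p : p != 0 -> hat p != 0 by move=> ?; rewrite comp_linp_neq0 // invr_eq0.
have [a [b hab]] := scaling_identity (hat0 _ D0) (hat0 _ Q0).
exists N, a, b; split=> // m; set n := (N * m + 1)%N.
have n0 : n%:R != 0 :> algC by rewrite pnatr_eq0 /n addn1.
suff : fC n * n%:R ^+ b = n%:R ^+ a.
  rewrite /fC -(ratr_nat algC n) -!rmorphXn -rmorphM; exact: fmorph_inj.
apply: hab => //; apply/eqP; rewrite -subr_eq0; apply/eqP.
apply: (@poly_eq0_on_progression _ _ (N * n) 1); first by rewrite muln_gt0 Np /n addn1.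
have h1 t : (t <= n * t)%N by rewrite leq_pmull // /n addn1.
have h2 t : (t <= n ^ 2 * t + m)%N by rewrite (leq_trans _ (leq_addr _ _)) // leq_pmull // expn_gt0 /n addn1.
apply: eventually_imp (eventually_and (eventually_comp h1 hDQ) (eventually_comp h2 hDQ)) => t [e1 e2].
rewrite hornerD hornerN hornerZ !hornerM !(horner_comp _ (n%:R *: 'X)) !hornerZ !hornerX -!natrM.
(* The test points [x = 1 + N n t] are prime to [n], and both [x] and [n x] are [1] modulo [N]. *)
have E1 : (1 + N * n * t = N * (n * t) + 1)%N by rewrite addnC mulnA.
have E2 : (n * (1 + N * n * t) = N * (n ^ 2 * t + m) + 1)%N.
  rewrite mulnDr muln1 {1}/n expnS expn1; lia.
rewrite E2 E1 !hatE -e1 -e2 -E1 -E2 /fC f_mul ?rmorphM; first by ring.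
- by rewrite /n addn1.
- by [].
- by rewrite /coprime addnC mulnAC gcdnMDl gcdn1.
Qed.

Variable C0 : nat.
Hypothesis C0_gt0 : (0 < C0)%N.
Hypothesis f_int : forall n, (0 < n)%N ->
  exists (e : nat) (z : int), C0%:R ^+ e * f n = z%:~R.

(** If [b > a], then [f(n)] is the inverse of a positive power of [n]. For [n = N C0 + 1], which is
    prime to [C0], no power of [C0] clears this denominator. *)
Lemma nat_power_on_progression : exists (N k : nat), (0 < N)%N /\
  forall m, f (N * m + 1)%N = (N * m + 1)%:R ^+ k.
Proof.
have [N [a [b [Np h]]]] := power_on_progression.
have ba : (b <= a)%N.
  rewrite leqNgt; apply/negP => ab.
  pose n := (N * C0 + 1)%N; have n0 : n%:R != 0 :> rat by rewrite pnatr_eq0 /n addn1.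
  have fn : f n * n%:R ^+ (b - a) = 1.
    have na : n%:R ^+ a != 0 :> rat by rewrite expf_neq0.
    by apply: (mulIf na); rewrite -mulrA -exprD subnK ?mul1r ?h // ltnW.
  have [|e [z ez]] := f_int (n := n); first by rewrite /n addn1.
  have : (n%:Z ^+ (b - a) %| C0%:Z ^+ e)%Z.
    apply/dvdzP; exists z; apply: (@intr_inj rat).
    by rewrite rmorphM !rmorphXn /= -ez -mulrA fn mulr1.
  rewrite dvdzE !abszX /= => /(dvdn_trans (dvdn_exp _ (dvdnn n))) nC.
  have /gcdn_idPl : (n %| C0 ^ e)%N by apply: nC; rewrite subn_gt0.
  have /eqP-> : coprime n (C0 ^ e).
    by apply: coprimeXr; rewrite coprime_sym /coprime /n gcdnMDl gcdn1.
  rewrite /n; nia.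
exists N, (a - b)%N; split=> // m.
have nb : (N * m + 1)%:R ^+ b != 0 :> rat by rewrite expf_neq0 // pnatr_eq0 addn1.
by apply: (mulIf nb); rewrite h -exprD subnK.
Qed.

(** * Periodicity of the twisted function *)

Section Periodicity.
Variables (N k : nat).
Hypothesis N_gt0 : (0 < N)%N.
Hypothesis f_prog : forall m, f (N * m + 1)%N = (N * m + 1)%:R ^+ k.

Definition twist n := f n / n%:R ^+ k.

Lemma twist_mul : multiplicative_fun twist.
Proof.
move=> m n mp np co; rewrite /twist f_mul // natrM exprMn invfM.
by rewrite mulrACA.
Qed.

Lemma twist_prog x : (0 < x)%N -> x = 1 %[mod N] -> twist x = 1.
Proof.
move=> xp x1; have /dvdnP[m xm] : (N %| x - 1)%N by rewrite -eqn_mod_dvd ?x1.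
have -> : x = (N * m + 1)%N by rewrite mulnC -xm subnK.
by rewrite /twist f_prog divff // expf_neq0 // pnatr_eq0 addn1.
Qed.

(** For [w] inverse to [v] modulo [N] and prime to [v] and [v + N m], both [w v] and [w (v + N m)]
    are [1] modulo [N], where [twist] is 1; then [twist w] cancels. *)
Lemma twist_coprime v m : (0 < v)%N -> coprime v N -> twist (v + N * m)%N = twist v.
Proof.
move=> vp co; pose V := (v * (v + N * m))%N.
have Vp : (0 < V)%N by rewrite muln_gt0 vp addn_gt0 vp.
have coV : coprime N V.
  by rewrite coprimeMr coprime_sym co /coprime addnC mulnC gcdnMDl -/(coprime _ _) coprime_sym.
(* [v ^ (totient N).-1] is the inverse of [v] modulo [N]; residue 1 modulo [V] gives the
   coprimality, and adding [N * V] makes [w] positive. *)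
pose w := (chinese N V (v ^ (totient N).-1) 1 + N * V)%N.
have wp : (0 < w)%N by rewrite addn_gt0 muln_gt0 N_gt0 Vp orbT.
have wN : w = v ^ (totient N).-1 %[mod N].
  by rewrite /w addnC mulnC modnMDl chinese_modl.
have wV : w = 1 %[mod V] by rewrite /w addnC modnMDl chinese_modr.
have coVw : coprime V w by rewrite -coprime_modr wV coprime_modr coprimen1.
have wv : (w * v)%N = 1 %[mod N].
  by rewrite -modnMml wN modnMml -expnSr prednK ?totient_gt0 // Euler_exp_totient.
have co1 : coprime w v by rewrite coprime_sym (coprime_dvdl _ coVw) // dvdn_mulr.
have co2 : coprime w (v + N * m).
  by rewrite coprime_sym (coprime_dvdl _ coVw) // dvdn_mull.
have e1 : twist w * twist v = 1.
  by rewrite -twist_mul // twist_prog // muln_gt0 wp.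
have e2 : twist w * twist (v + N * m)%N = 1.
  rewrite -twist_mul // ?addn_gt0 ?vp // twist_prog // ?muln_gt0 ?wp ?addn_gt0 ?vp //.
  by rewrite mulnDr mulnCA addnC mulnC modnMDl.
have w0 : twist w != 0 by apply: contra_eqN e1 => /eqP->; rewrite mul0r eq_sym oner_eq0.
by apply: (mulfI w0); rewrite e1 e2.
Qed.

(** Write [n = u v], where [u] collects the primes dividing [N]. Then [n + u N m = u (v + N m)] with
    both factors coprime, and [twist_coprime] applies to the second. *)
Lemma twist_local_period n : (0 < n)%N ->
  exists2 M, (0 < M)%N & forall m, twist (n + M * m)%N = twist n.
Proof.
move=> np; pose u := (n`_(\pi(N)))%N; pose v := (n`_(\pi(N)^'))%N.
have uv : n = (u * v)%N by rewrite partnC.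
have up : (0 < u)%N := part_gt0 _ _; have vp : (0 < v)%N := part_gt0 _ _.
have coN x : (0 < x)%N -> coprime N x -> coprime u x.
  by move=> xp; rewrite coprime_pi' // => hx; exact: pnat_coprime (part_pnat _ _) hx.
have coNv : coprime N v by rewrite coprime_pi' // part_pnat.
exists (u * N)%N; first by rewrite muln_gt0 up.
move=> m; rewrite {1}uv -mulnA -mulnDr uv !twist_mul //.
- by rewrite twist_coprime // coprime_sym.
- exact: coN.
- by rewrite addn_gt0 vp.
- apply: coN; first by rewrite addn_gt0 vp.
  by rewrite addnC mulnC /coprime gcdnMDl.
Qed.

Lemma twist_common_period l n : (0 < n)%N ->
  exists2 M, (0 < M)%N & forall s m, (s < l)%N -> twist (n + s + M * m)%N = twist (n + s)%N.
Proof.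
move=> np; elim: l => [|l [M Mp hM]]; first by exists 1.
have [|M' Mp' hM'] := twist_local_period (n := (n + l)%N); first by rewrite addn_gt0 np.
exists (M * M')%N; first by rewrite muln_gt0 Mp.
move=> s m; rewrite ltnS leq_eqVlt => /orP[/eqP->|sl]; last by rewrite -mulnA hM.
by rewrite mulnAC [(_ * M')%N]mulnC hM'.
Qed.

(** Along [n + M m] the values of [twist] are frozen, so the recurrence of [f] becomes an identity
    between the polynomials [T s]. The coefficient in the degree of [T r] gives constants with [a r]
    nonzero. *)
Lemma twist_recurrence : exists2 a : nat -> rat, a r != 0
  & forall n, (0 < n)%N -> \sum_(s < r.+1) a s * twist (n + s)%N = 0.
Proof.
pose T s := P s * ('X + s%:R%:P) ^+ k.
have Tr : T r != 0 by rewrite mulf_neq0 // expf_neq0 // -size_poly_gt0 size_XaddC.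
exists (fun s => (T s)`_(size (T r)).-1); first by rewrite -lead_coefE lead_coef_eq0.
move=> n np; have [M Mp hM] := twist_common_period r.+1 np.
have Z0 : \sum_(s < r.+1) twist (n + s)%N *: T s = 0.
  apply: (@poly_eq0_on_progression _ _ M n Mp).
  have hm m : (m <= n + M * m)%N by nia.
  apply: eventually_imp (eventually_comp hm f_rec) => m e; rewrite -[RHS]e horner_sum.
  apply: eq_bigr => s _; rewrite hornerZ hornerM horner_exp hornerD hornerX hornerC -natrD.
  have -> : twist (n + s)%N = twist (n + M * m + s)%N.
    by rewrite -(hM s m (ltn_ord s)) addnAC.
  rewrite mulrCA /twist divfK // expf_neq0 // pnatr_eq0; lia.
have := congr1 (fun p : {poly rat} => p`_(size (T r)).-1) Z0; rewrite coef0 coef_sum => e; rewrite -[RHS]e.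
by apply: eq_bigr => s _; rewrite coefZ mulrC.
Qed.

Lemma twist_periodic : periodic_fun twist.
Proof.
have [a ar ha] := twist_recurrence.
have [M Mp hM] := twist_common_period r (ltn0Sn 0); exists M => // n np.
elim/ltn_ind: n np => n IH np; have [nr|rn] := leqP n r.
  by have := hM n.-1 1%N; rewrite add1n prednK // muln1 => -> //; lia.
apply: (mulfI ar); have n' : (0 < n - r)%N by lia.
have e1 := ha _ n'; have e2 := ha (n - r + M)%N (ltn_addr _ n').
move: e1 e2; rewrite !big_ord_recr /= => /eqP; rewrite addrC addr_eq0 => /eqP e1.
move=> /eqP; rewrite addrC addr_eq0 => /eqP e2.
rewrite -[in RHS](subnK (ltnW rn)) e1.
rewrite (_ : n + M = n - r + M + r)%N ?e2; last by lia.
congr (- _); apply: eq_bigr => s _; congr (_ * _).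
rewrite addnAC IH //; first by have := ltn_ord s; lia.
by rewrite addn_gt0 n'.
Qed.

End Periodicity.

Lemma power_times_periodic : exists (k : nat) (chi : nat -> rat),
    [/\ periodic_fun chi, multiplicative_fun chi
      & forall n : nat, (0 < n)%N -> f n = n%:R ^+ k * chi n].
Proof.
have [N [k [Np h]]] := nat_power_on_progression.
exists k, (twist k); split; [exact: twist_periodic h | exact: twist_mul | move=> n np].
by rewrite /twist mulrC divfK // expf_neq0 // pnatr_eq0 -lt0n.
Qed.

End Multiplicative.

(** * Algebraic power series *)

Section AlgebraicSeries.
Variable K : numFieldType.
Local Notation iota := (@fps_of_poly K).
Implicit Types (F x y : fps K) (Q : {poly {poly K}}).

Definition fev F Q : fps K := (map_poly iota Q).[F].

Lemma fevD F Q Q' : fev F (Q + Q') = fev F Q + fev F Q'.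
Proof. by rewrite /fev rmorphD hornerD. Qed.
Lemma fevN F Q : fev F (- Q) = - fev F Q.
Proof. by rewrite /fev rmorphN hornerN. Qed.
Lemma fevM F Q Q' : fev F (Q * Q') = fev F Q * fev F Q'.
Proof. by rewrite /fev rmorphM hornerM. Qed.
Lemma iotaM (a b : {poly K}) : iota (a * b) = iota a * iota b.
Proof. exact: rmorphM. Qed.
Lemma fevC F c : fev F c%:P = iota c.
Proof. by rewrite /fev map_polyC hornerC. Qed.
Lemma fevX F : fev F 'X = F.
Proof. by rewrite /fev map_polyX hornerX. Qed.
Lemma fev0 F : fev F 0 = 0.
Proof. by rewrite /fev rmorph0 horner0. Qed.
Lemma fev_exp F Q n : fev F (Q ^+ n) = fev F Q ^+ n.
Proof. by rewrite /fev rmorphXn horner_exp. Qed.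
Lemma fev_comp F Q Q' : fev F (Q \Po Q') = fev (fev F Q') Q.
Proof. by rewrite /fev map_comp_poly horner_comp. Qed.

Lemma algebraic_fpsP F : algebraic_fps F -> exists2 Q, Q != 0 & fev F Q = 0.
Proof.
move=> [p p0 pF].
have [D [P [D0 DP]]] := common_denominator (\row_(i < size p) p`_i).
pose Q : {poly {poly K}} := \poly_(i < size p) (if insub i is Some j then P 0 j else 0).
have QE : D%:F *: p = map_poly (@FracField.tofrac _) Q.
  apply/polyP => i; rewrite coefZ coef_map coef_poly.
  case: ltnP => ip; last by rewrite nth_default // mulr0 raddf0.
  by have /rowP/(_ (Ordinal ip)) := DP; rewrite !mxE insubT.
exists Q.
  apply: contraNneq p0 => Q0; move: QE; rewrite Q0 map_poly0 => /eqP.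
  by rewrite scale_poly_eq0 tofrac_eq0 (negPf D0).
have e : (map_poly (laurent_of_ratfun (K := K)) (D%:F *: p)).[F%:F] = 0.
  by rewrite -mul_polyC rmorphM hornerM (rootP pF) mulr0.
have iotaE (u : {poly K}) : laurent_of_ratfun u%:F = (iota u)%:F.
  by rewrite -[u%:F]divr1 -tofrac1 laurent_of_ratfunE ?oner_neq0 // rmorph1 tofrac1 divr1.
apply/eqP; rewrite -tofrac_eq0 /fev -horner_map /= -map_poly_comp -[X in _ == X]e QE -map_poly_comp.
by apply/eqP; congr (_.[_]); apply: eq_map_poly => u /=; rewrite iotaE.
Qed.

(** The Euler operator [z d/dz]; its iterates multiply the coefficients by powers of the index. *)
Definition theta x : fps K := Fps (fun n => n%:R * fcoef x n).

Lemma thetaD x y : theta (x + y) = theta x + theta y.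
Proof. by apply/fpsP => n /=; rewrite mulrDr. Qed.

Lemma thetaM x y : theta (x * y) = theta x * y + x * theta y.
Proof.
apply/fpsP => n; rewrite /= mulr_sumr -big_split /=; apply: eq_bigr => i _.
have -> : n%:R = (i : nat)%:R + (n - i)%:R :> K by rewrite -natrD subnKC // -ltnS.
by ring.
Qed.

Lemma theta_poly (p : {poly K}) : theta (iota p) = iota ('X * p^`()).
Proof.
apply/fpsP => n /=; rewrite ['X * _]mulrC coefMX coef_deriv; case: n => [|n] //=.
  by rewrite mul0r.
by rewrite mulr_natl.
Qed.

(** The chain rule; [Q1] collects the derivatives of the coefficients of [Q]. *)
Lemma theta_fev F Q : exists Q1, theta (fev F Q) = fev F Q1 + fev F Q^`() * theta F.
Proof.
elim/poly_ind: Q => [|Q c [Q1 IH]].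
  exists 0; rewrite derivC !fev0 mul0r addr0; apply/fpsP => n /=; by rewrite mulr0.
exists (Q1 * 'X + ('X * c^`())%:P).
rewrite !(fevD, fevM, fevC, fevX) thetaD thetaM IH theta_poly derivD derivC addr0.
by rewrite derivM derivX mulr1 fevD fevM fevX; ring.
Qed.

(** * From a minimal equation to a polynomial recurrence *)

Section MinimalEquation.
Variables (F : fps K) (PP : {poly {poly K}}).
Hypothesis PP0 : PP != 0.
Hypothesis PPF : fev F PP = 0.
Hypothesis PPmin : forall Q, Q != 0 -> fev F Q = 0 -> (size PP <= size Q)%N.

Lemma size_PP : (1 < size PP)%N.
Proof.
rewrite ltnNge; apply/negP => /size1_polyC PPE; case/negP: PP0; move: PPF.
rewrite PPE fevC => e; rewrite polyC_eq0; apply/eqP.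
by apply: (@fps_of_poly_inj K); rewrite e rmorph0.
Qed.

(** Separability: in characteristic zero the derivative is nonzero, and it is smaller than the
    minimal [PP]. *)
Lemma deriv_PP_neq0 : fev F PP^`() != 0.
Proof.
have s1 := size_PP.
have s : (size PP^`() < size PP)%N by rewrite lt_size_deriv.
have d0 : PP^`() != 0.
  apply/negP => /eqP /polyP/(_ (size PP).-2); rewrite coef_deriv coef0 => /eqP.
  rewrite prednK; last by rewrite -ltnS prednK //; exact: ltnW.
  rewrite -mulr_natr mulf_eq0 -lead_coefE lead_coef_eq0 (negPf PP0) /= -polyC_natr polyC_eq0 pnatr_eq0.
  by move: s1; case: (size PP) => [|[|?]].
by apply/negP => /eqP /(PPmin d0); rewrite leqNgt s.
Qed.

(** The power series lying in the [K(z)]-span of the powers of [F]. *)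
Definition fgen x := exists (D : {poly K}) Q, D != 0 /\ iota D * x = fev F Q.

Lemma fgen_fev Q : fgen (fev F Q).
Proof. by exists 1, Q; rewrite oner_neq0 rmorph1 mul1r. Qed.

Lemma fgen_small x : fgen x -> exists (D : {poly K}) Q,
  [/\ D != 0, (size Q <= (size PP).-1)%N & iota D * x = fev F Q].
Proof.
move=> [D [Q [D0 DQ]]].
exists (lead_coef PP ^+ scalp Q PP * D), (Q %% PP); split.
- by rewrite mulf_neq0 // expf_neq0 // lead_coef_eq0.
- by have := PP0; rewrite -(Pdiv.Idomain.ltn_modp Q); case: (size PP) size_PP.
rewrite iotaM -mulrA DQ -(fevC F) -fevM mul_polyC Pdiv.Idomain.divp_eq.
by rewrite fevD fevM PPF mulr0 add0r.
Qed.

(** Pseudo-division by [PP] places all the [x i] in a space of dimension [(size PP).-1], one less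
    than their number. *)
Lemma fgen_dependent (x : nat -> fps K) : (forall i, fgen (x i)) ->
  exists2 a : 'I_(size PP) -> {poly K}, exists i, a i != 0 & \sum_i iota (a i) * x i = 0.
Proof.
move=> hx; have /choice[D /choice[Q h]] := fun i => fgen_small (hx i).
pose M : 'M[{poly K}]_(size PP, (size PP).-1) := \matrix_(i, j) (Q i)`_j.
have : ~~ row_free (map_mx (@FracField.tofrac _) M).
  rewrite /row_free neq_ltn; apply/orP; left; apply: leq_ltn_trans (rank_leq_col _) _.
  by case: (size PP) size_PP.
move=> /left_kernel[a [a0 aM]].
have {}aM : a *m M = 0 by apply: map_tofrac_inj; rewrite map_mxM aM map_mx0.
exists (fun i => a 0 i * D i).
  have [i ai] : exists i, a 0 i != 0.
    apply: contrapT => no; case/negP: a0; apply/eqP/rowP => i; rewrite mxE.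
    by apply/eqP; apply: contrapT => /negP ai; apply: no; exists i.
  by exists i; rewrite mulf_neq0 //; case: (h i).
transitivity (fev F (\sum_i (a 0 i)%:P * Q i)).
  rewrite /fev rmorph_sum horner_sum; apply: eq_bigr => i _.
  by rewrite -/(fev F _) fevM fevC iotaM -mulrA; case: (h i) => _ _ ->.
suff -> : \sum_i (a 0 i)%:P * Q i = 0 by rewrite fev0.
apply/polyP => j; rewrite coef_sum coef0; have [js|js] := ltnP j (size PP).-1; last first.
  rewrite big1 // => i _; rewrite coefCM nth_default ?mulr0 //.
  by case: (h i) => _ s _; exact: leq_trans s js.
have /rowP/(_ (Ordinal js)) := aM; rewrite !mxE => e; rewrite -[RHS]e.
by apply: eq_bigr => i _; rewrite coefCM mxE.
Qed.

(** The powers of [w = fev F Q] are dependent. Dividing the relation by a power of [w] leaves a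
    nonzero constant term, which is then a multiple of [w]. *)
Lemma fgen_inverse Q : fev F Q != 0 ->
  exists (D : {poly K}) V, D != 0 /\ iota D = fev F V * fev F Q.
Proof.
move=> w0; set w := fev F Q.
have [|a [i0 ai0] ha] := fgen_dependent (x := fun i => w ^+ i).
  by move=> i; rewrite -fev_exp; exact: fgen_fev.
pose A : {poly {poly K}} := \poly_(i < size PP) (if insub i is Some j then a j else 0).
have A0 : A != 0.
  apply: contraNneq ai0 => A0; have /polyP/(_ i0) := A0.
  by rewrite coef_poly ltn_ord valK coef0 => ->.
have Aw : fev w A = 0.
  rewrite -[RHS]ha /fev (horner_coef_wide _ (n := size PP)); last first.
    by apply: leq_trans (size_poly _ _) _; exact: size_poly.
  by apply: eq_bigr => i _; rewrite coef_map coef_poly ltn_ord valK.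
have [m [A1 hA1 AE]] := multiplicity_XsubC A 0.
rewrite A0 /= subr0 in hA1 AE.
have A1w : fev w A1 = 0.
  move: Aw; rewrite AE fevM fev_exp fevX => /eqP; rewrite mulf_eq0 expf_eq0 (negPf w0) andbF orbF.
  by move/eqP.
have [V [c A1E]] : exists V c, A1 = V * 'X + c%:P.
  elim/poly_ind: (A1) => [|V c _]; first by exists 0, 0; rewrite mul0r addr0.
  by exists V, c.
exists c, (- (V \Po Q)); split.
  by move: hA1; rewrite A1E rootE hornerMXaddC mulr0 add0r.
apply/eqP; rewrite fevN fev_comp -/w mulNr -addr_eq0 -{2}(fevX w) -fevM -(fevC w) addrC -fevD -A1E.
exact/eqP.
Qed.

(** Applying [theta] to [PP(F) = 0] gives [theta F = - Q1(F) / PP'(F)], and [fgen_inverse] replaces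
    the division by a polynomial denominator. *)
Lemma fgen_theta x : fgen x -> fgen (theta x).
Proof.
have [D [V [D0 DV]]] := fgen_inverse deriv_PP_neq0.
have [Q1 hQ1] := theta_fev F PP.
have thF : iota D * theta F = fev F (- (V * Q1)).
  have z : theta 0 = 0 by apply/fpsP => n /=; rewrite mulr0.
  have : fev F Q1 + fev F PP^`() * theta F = 0 by rewrite -hQ1 PPF.
  rewrite DV fevN fevM -mulrA => /eqP; rewrite addrC addr_eq0 => /eqP ->.
  by rewrite mulrN.
move=> [E [Q [E0 EQ]]]; have [Q2 hQ2] := theta_fev F Q.
have : theta (iota E * x) = theta (fev F Q) by rewrite EQ.
rewrite thetaM hQ2 theta_poly => e.
exists (E * E * D), (E%:P * D%:P * Q2 - E%:P * (Q^`() * (V * Q1)) - ('X * E^`())%:P * D%:P * Q).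
rewrite !mulf_neq0 //; split=> //.
have e2 : iota E * theta x = fev F Q2 + fev F Q^`() * theta F - iota ('X * E^`()) * x.
  by rewrite -e [X in X - _]addrC addrK.
rewrite !(fevD, fevN, fevM, fevC) -EQ !iotaM.
transitivity (iota E * iota D * (iota E * theta x)); first by ring.
rewrite e2 !iotaM; transitivity (iota E * iota D * fev F Q2 + iota E * fev F Q^`() * (iota D * theta F)
  - iota E * iota D * (iota 'X * iota E^`() * x)); first by ring.
by rewrite thF fevN fevM; ring.
Qed.

Lemma minimal_recurrence : exists (r : nat) (P : nat -> {poly K}), P r != 0 /\
  forall n, \sum_(s < r.+1) (P s).[n%:R] * fcoef F (n + s)%N = 0.
Proof.
have hx i : fgen (iter i theta F).
  elim: i => [|i IH] /=; last exact: fgen_theta.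
  by rewrite -[F]fevX; exact: fgen_fev.
have [a [i0 ai0] ha] := fgen_dependent hx.
have itheta i n : fcoef (iter i theta F) n = n%:R ^+ i * fcoef F n.
  by elim: i => [|i IH] /=; rewrite ?mul1r // IH exprS mulrA.
pose J := (\max_i size (a i))%N.
have sJ i : (size (a i) <= J)%N by exact: leq_bigmax.
(* In the relation between the [theta^i F], the terms in [z^j] multiply the coefficient of [F] at
   index [y] by [(R j).[y]]. At total degree [n + J.-1] that index is [n + s] with [s = J.-1 - j],
   whence [P]. *)
pose R j : {poly K} := \poly_(i < size PP) (if insub i is Some i' then (a i')`_j else 0).
have RE j (y : K) : (R j).[y] = \sum_i (a i)`_j * y ^+ i.
  rewrite (horner_coef_wide _ (n := size PP)) ?size_poly //.
  by apply: eq_bigr => i _; rewrite coef_poly ltn_ord valK.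
pose P s := R (J.-1 - s)%N \Po linp 1 s%:R.
have J0 : (0 < J)%N by apply: leq_trans (sJ i0); rewrite size_poly_gt0.
have [s0 s0J Ps0] : exists2 s, (s < J)%N & P s != 0.
  pose j := (size (a i0)).-1.
  have jJ : (j < J)%N by rewrite prednK ?size_poly_gt0.
  exists (J.-1 - j)%N; first by lia.
  rewrite comp_linp_neq0 ?oner_neq0 // subKn; last by lia.
  apply/negP => /eqP/polyP/(_ i0); rewrite coef_poly ltn_ord valK coef0.
  by move/eqP; rewrite -lead_coefE lead_coef_eq0 (negPf ai0).
have ex : exists s, (s < J)%N && (P s != 0) by exists s0; rewrite s0J.
have bnd s : (s < J)%N && (P s != 0) -> (s <= J)%N by move=> /andP[/ltnW].
(* [r] is the last index with [P r] nonzero, so the sum may stop there. *)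
case: (ex_maxnP ex bnd) => r /andP[rJ Pr] rmax; exists r, P; split=> // n.
have hrec : \sum_(s < J) (P s).[n%:R] * fcoef F (n + s)%N = 0.
  have /fpsP/(_ (n + J.-1)%N) := ha.
  have -> : fcoef (\sum_i iota (a i) * iter i theta F) (n + J.-1)%N =
      \sum_i fcoef (iota (a i) * iter i theta F) (n + J.-1)%N.
    exact: (big_morph (fun x : fps K => fcoef x (n + J.-1)%N)).
  move=> e; rewrite -[RHS]e; transitivity
    (\sum_(i < size PP) \sum_(j < J) (a i)`_j * ((n + J.-1 - j)%:R ^+ i * fcoef F (n + J.-1 - j)%N)).
    rewrite exchange_big /= [LHS](reindex_inj rev_ord_inj) /=; apply: eq_bigr => j _.
    rewrite horner_comp horner_linp mul1r -natrD RE mulr_suml.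
    have -> : (J.-1 - (J - j.+1) = j)%N by have := ltn_ord j; lia.
    have -> : (n + (J - j.+1) = n + J.-1 - j)%N by have := ltn_ord j; lia.
    by apply: eq_bigr => i _; rewrite mulrA.
  apply: eq_bigr => i _; rewrite fcoefM /=.
  rewrite [RHS](eq_bigr (fun j : 'I_(n + J.-1).+1 => (a i)`_j * ((n + J.-1 - j)%:R ^+ i * fcoef F (n + J.-1 - j)%N))); last first.
    by move=> j _; rewrite itheta.
  have JJ : (J <= (n + J.-1).+1)%N by lia.
  rewrite (big_ord_widen _ (fun j => (a i)`_j * ((n + J.-1 - j)%:R ^+ i * fcoef F (n + J.-1 - j)%N)) JJ).
  rewrite big_mkcond; apply: eq_bigr => j _; case: ltnP => // Jj.
  by rewrite nth_default ?mul0r // (leq_trans (sJ i)).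
rewrite -[RHS]hrec (big_ord_widen _ (fun s => (P s).[n%:R] * fcoef F (n + s)%N) rJ).
rewrite big_mkcond; apply: eq_bigr => s _; case: ltnP => // rs.
have [->|Ps] := eqVneq (P s) 0; first by rewrite horner0 mul0r.
by have := rmax s; rewrite ltn_ord Ps => /(_ isT); lia.
Qed.

End MinimalEquation.

Lemma minimal_equation F : algebraic_fps F -> exists PP : {poly {poly K}},
  [/\ PP != 0, fev F PP = 0 & forall Q, Q != 0 -> fev F Q = 0 -> (size PP <= size Q)%N].
Proof.
move=> /algebraic_fpsP[Q Q0 QF].
have ex : exists s, `[< exists2 L, L != 0 /\ fev F L = 0 & size L = s >].
  by exists (size Q); apply/asboolP; exists Q.
case: (ex_minnP ex) => s /asboolP[PP [PP0 PPF] sPP] smin; exists PP; split=> // L L0 LF.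
by rewrite sPP; apply: smin; apply/asboolP; exists L.
Qed.

End AlgebraicSeries.

(** * Denominators of algebraic series *)

Section Eisenstein.

(** Membership in the ring of integers with [c] inverted. *)
Definition integral_away (c : nat) (x : rat) :=
  exists (e : nat) (z : int), c%:R ^+ e * x = z%:~R.

Lemma integral_awayD c x y : integral_away c x -> integral_away c y -> integral_away c (x + y).
Proof.
move=> [e [z h]] [e' [z' h']]; exists (e + e')%N, (c%:Z ^+ e' * z + c%:Z ^+ e * z').
rewrite rmorphD !rmorphM !rmorphXn /= -h -h' exprD; ring.
Qed.

Lemma integral_awayM c x y : integral_away c x -> integral_away c y -> integral_away c (x * y).
Proof.
move=> [e [z h]] [e' [z' h']]; exists (e + e')%N, (z * z').
by rewrite rmorphM /= -h -h' exprD; ring.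
Qed.

Lemma integral_away_int c (z : int) : integral_away c z%:~R.
Proof. by exists 0%N, z; rewrite mul1r. Qed.

Lemma integral_awayN c x : integral_away c x -> integral_away c (- x).
Proof. by move=> [e [z h]]; exists e, (- z); rewrite mulrN h rmorphN. Qed.

Lemma integral_away_mul c c' x : integral_away c x -> integral_away (c' * c) x.
Proof.
move=> [e [z h]]; exists e, (c'%:Z ^+ e * z).
by rewrite natrM exprMn -mulrA h rmorphM rmorphXn.
Qed.

Lemma integral_away_seq (s : seq rat) : exists2 c, (0 < c)%N & forall x, x \in s -> integral_away c x.
Proof.
elim: s => [|x s [c cp hc]]; first by exists 1.
exists (c * `|denq x|)%N; first by rewrite muln_gt0 cp absz_gt0 denq_eq0.
move=> y; rewrite inE => /orP[/eqP->|/hc h]; last by rewrite mulnC; exact: integral_away_mul.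
apply: integral_away_mul; exists 1%N, (numq x).
rewrite expr1 -{2}[x]divq_num_den natr_absz ger0_norm ?denq_ge0 // mulrC divfK //.
by rewrite intr_eq0 denq_eq0.
Qed.

Definition fps_away c (x : fps rat) := forall n, integral_away c (fcoef x n).

Lemma integral_away_sum c (I : finType) (g : I -> rat) :
  (forall i, integral_away c (g i)) -> integral_away c (\sum_i g i).
Proof.
move=> h; elim/big_ind: _ => // [|x y]; first exact: (integral_away_int c 0).
exact: integral_awayD.
Qed.

Lemma fps_awayM c x y : fps_away c x -> fps_away c y -> fps_away c (x * y).
Proof. by move=> hx hy n; apply: integral_away_sum => i; exact: integral_awayM. Qed.

Lemma fps_away_exp c x n : fps_away c x -> fps_away c (x ^+ n).
Proof.
move=> hx; elim: n => [|n IH]; last by rewrite exprS; exact: fps_awayM.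
by rewrite expr0 => n /=; exact: (integral_away_int c (n == 0)%N).
Qed.

Lemma fps_away_horner c (q : {poly fps rat}) x :
  (forall i, fps_away c q`_i) -> fps_away c x -> fps_away c q.[x].
Proof.
move=> hq hx; rewrite horner_coef; elim/big_ind: _ => [n|u v hu hv n|i _].
- exact: (integral_away_int c 0).
- exact: integral_awayD.
- by apply: fps_awayM => //; exact: fps_away_exp.
Qed.

Lemma horner_first_order (R : comNzRingType) (q : {poly R}) x h :
  exists z, q.[x + h] = q.[x] + h * z.
Proof.
elim/poly_ind: q => [|q c [z IH]]; first by exists 0; rewrite !horner0 mulr0 addr0.
by exists (z * (x + h) + q.[x]); rewrite !hornerMXaddC IH; ring.
Qed.

Lemma horner_second_order (R : comNzRingType) (q : {poly R}) x h :
  exists z, q.[x + h] = q.[x] + h * q^`().[x] + h * (h * z).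
Proof.
elim/poly_ind: q => [|q c [z IH]].
  by exists 0; rewrite derivC !horner0 !mulr0 !addr0.
exists (z * (x + h) + q^`().[x]); rewrite !hornerMXaddC IH.
by rewrite derivD derivC addr0 derivM derivX mulr1 hornerD hornerM hornerX; ring.
Qed.

Lemma fcoef_Xn_mul n x m :
  fcoef (fps_of_poly 'X^n * x) m = if (m < n)%N then 0 else fcoef x (m - n) :> rat.
Proof.
rewrite fcoefM /=; case: ltnP => mn.
  rewrite big1 // => i _; rewrite coefXn; case: eqP => [e|]; last by rewrite mul0r.
  by have := ltn_ord i; lia.
have nm : (n < m.+1)%N by [].
rewrite (bigD1 (Ordinal nm)) //= coefXn eqxx mul1r big1 ?addr0 // => i.
by rewrite -val_eqE /= coefXn => /negPf->; rewrite mul0r.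
Qed.

Lemma fcoefD (x y : fps rat) n : fcoef (x + y) n = fcoef x n + fcoef y n.
Proof. by []. Qed.

(* With [w = PP'(F)] of order [e], the coefficient of [z^(n+e)] in [PP(F) = 0] determines
   [F_n] from the earlier coefficients after division by [w_e] only. *)
Theorem eisenstein (F : fps rat) : algebraic_fps F ->
  exists2 c, (0 < c)%N & fps_away c F.
Proof.
move=> /minimal_equation[PP [PP0 PPF PPmin]].
have := deriv_PP_neq0 PP0 PPF PPmin; set w := fev F PP^`() => /fps_neq0P[e we wlt].
(* All rationals used by the recursion: the coefficients of [PP], the inverse of [w_e], and the
   initial coefficients of [F]. *)
pose s := flatten [seq polyseq u | u <- polyseq PP] ++ (fcoef w e)^-1 :: [seq fcoef F i | i <- iota 0 e.+1].
have [c cp hc] := integral_away_seq s; exists c => // n.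
pose q := map_poly (@fps_of_poly rat) PP.
have hq i : fps_away c q`_i.
  move=> j; rewrite coef_map /=; have [iP|iP] := ltnP i (size PP); last first.
    by rewrite (nth_default 0 iP) coef0; exact: (integral_away_int c 0).
  have [jP|jP] := ltnP j (size PP`_i); last by rewrite nth_default //; exact: (integral_away_int c 0).
  apply: hc; rewrite mem_cat; apply/orP; left; apply/flattenP.
  by exists (polyseq PP`_i); rewrite ?mem_nth //; apply: map_f; exact: mem_nth.
elim/ltn_ind: n => n IH; have [ne|en] := leqP n e.
  apply: hc; rewrite mem_cat inE; apply/orP; right; apply/orP; right.
  by apply: map_f; rewrite mem_iota.
pose T : fps rat := Fps (fun i => if (i < n)%N then fcoef F i else 0).
pose R : fps rat := Fps (fun i => fcoef F (n + i)%N).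
pose zn := fps_of_poly ('X^n : {poly rat}).
have FE : F = T + zn * R.
  apply/fpsP => m; rewrite fcoefD fcoef_Xn_mul /=; case: ltnP => mn; rewrite ?addr0 // add0r.
  by rewrite subnKC.
have hT : fps_away c T.
  by move=> i /=; case: ltnP => [/IH //|_]; exact: (integral_away_int c 0).
have [z hz] := horner_second_order q T (zn * R).
have [z' hz'] := horner_first_order q^`() T (zn * R).
(* [T] and [F] agree below order [n], hence so do [PP'(T)] and [w]. *)
have wT i : (i < n)%N -> fcoef q^`().[T] i = fcoef w i.
  move=> ni; have -> : w = q^`().[T + zn * R] by rewrite -FE /w /fev deriv_map.
  by rewrite hz' fcoefD -mulrA fcoef_Xn_mul ni addr0.
have q0 : q.[T + zn * R] = 0 by rewrite -FE; exact: PPF.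
have := congr1 (fun x => fcoef x (n + e)%N) q0; rewrite hz.
have -> : zn * R * q^`().[T] = zn * (R * q^`().[T]) by rewrite mulrA.
(* The quadratic term starts at order [2 n > n + e], so it does not reach the coefficient
   considered. *)
have -> : zn * R * (zn * R * z) = zn * (zn * (R * (R * z))) by ring.
rewrite !fcoefD !fcoef_Xn_mul ltnNge leq_addr /= addKn en addr0.
have -> : \sum_(i < e.+1) fcoef R i * fcoef q^`().[T] (e - i) = fcoef F n * fcoef w e.
  rewrite big_ord_recl /= addn0 subn0 wT // big1 ?addr0 // => i _.
  rewrite wT; last by lia.
  by rewrite wlt ?mulr0 // /bump /=; have := ltn_ord i; lia.
move=> /eqP; rewrite addrC addr_eq0 => /eqP h.
have -> : fcoef F n = - fcoef q.[T] (n + e) * (fcoef w e)^-1 by rewrite -h mulfK.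
apply: integral_awayM; first by apply: integral_awayN; exact: fps_away_horner.
by apply: hc; rewrite mem_cat inE eqxx orbT.
Qed.

End Eisenstein.

Theorem theorem3p2 (f : nat -> rat) :
  multiplicative_fun f ->
  algebraic_fps (genfun f) ->
  eventually_zero f \/
  exists (k : nat) (chi : nat -> rat),
    [/\ periodic_fun chi, multiplicative_fun chi
      & forall n : nat, (0 < n)%N -> f n = n%:R ^+ k * chi n].
Proof.
move=> f_mul alg; have [ez|nz] := pselect (eventually_zero f); [by left | right].
have [PP [PP0 PPF PPmin]] := minimal_equation alg.
have [r [P [Pr hP]]] := minimal_recurrence PP0 PPF PPmin.
have [c cp hc] := eisenstein alg.
apply: (@power_times_periodic f r P f_mul nz Pr _ c cp) => [|n np].
  (* The recurrence is read from [n = 1] on, since [genfun f] has constant coefficient 0 instead of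
     [f 0]. *)
  exists 1%N => n np; rewrite -[RHS](hP n); apply: eq_bigr => s _ /=.
  by case: (n + s)%N (ltn_addr s np).
by have := hc n; rewrite /fps_away /=; case: n np.
Qed.
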